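(* Let $\beta>0$ be real, and let $\rho(x)$ be a real-valued function of real $x$ whose complex extension $\rho(z)$ is an entire function. Assume that $\rho(x)/x^{2}$ is integrable at infinity (i.e. on $[c,\infty)$ for $c>0$). Then the generalized Stieltjes integral $$S(\beta)=\int_{0}^{\infty}\frac{\rho(x)}{1/\beta+x^{2}}\,\mathrm{d}x$$ admits the exact convergent expansion $$S(\beta)=\sum_{k=0}^{\infty}\frac{(-1)^k}{\beta^k}\,\mu_{-(2k+2)}+\Delta(\beta),$$ where $$\Delta(\beta)=\frac{\pi\sqrt{\beta}}{4}\left(\rho\left(\frac{i}{\sqrt{\beta}}\right)+\rho\left(\frac{-i}{\sqrt{\beta}}\right)\right)+\frac{\sqrt{\beta}\,\ln\beta}{4i}\left(\rho\left(\frac{i}{\sqrt{\beta}}\right)-\rho\left(\frac{-i}{\sqrt{\beta}}\right)\right),$$ and $\mu_{-(2k+2)}$ is the Hadamard finite part of the (generally divergent) integral $\int_{0}^{\infty}\rho(x)\,x^{-(2k+2)}\,\mathrm{d}x$.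
   Context: Hadamard finite part. Let $f$ be analytic on $[0,a]$ and let $m\ge 1$ be an integer. For $0<\epsilon<a$ write $\int_{\epsilon}^{a} f(x)x^{-m}\,\mathrm{d}x=C_{\epsilon}+D_{\epsilon}$, where $D_{\epsilon}$ is a finite linear combination (with coefficients independent of $\epsilon$) of inverse powers $\epsilon^{-j}$, $j\ge 1$, and $\ln\epsilon$, and $C_\epsilon$ has a finite limit as $\epsilon\to0^+$. This determines $D_\epsilon$ uniquely. The finite part of $\int_0^a f(x)x^{-m}\,\mathrm{d}x$ is defined to be $\lim_{\epsilon\to0^+}C_{\epsilon}$. When $f(x)x^{-m}$ is integrable at infinity, the finite part of $\int_0^\infty f(x)x^{-m}\,\mathrm{d}x$ is defined as the limit as $a\to\infty$ of the finite part of $\int_0^a f(x)x^{-m}\,\mathrm{d}x$. *)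

(* Defs.v *)
From Stdlib Require Import Reals.
From Coquelicot Require Import Coquelicot.

Open Scope R_scope.

(* Complex differentiability at every point.  The module structure is given
   explicitly so that this is the derivative over the field C. *)
Definition entire (f : C -> C) : Prop :=
  forall z : C, ex_derive (K := C_AbsRing) (V := C_NormedModule) f z.

(* [sum_n_m u 1 n] is u 1 + ... + u n, and is 0 when n = 0. *)
Definition divergent_terms (n : nat) (d : nat -> R) (l : R) (eps : R) : R :=
  sum_n_m (fun j => d j / eps ^ j) 1 n + l * ln eps.

Definition is_finite_part (f : R -> R) (m : nat) (a v : R) : Prop :=
  exists (c : R -> R) (n : nat) (d : nat -> R) (l : R),
    (forall eps : R, 0 < eps < a ->
       is_RInt (fun x => f x / x ^ m) eps a (c eps + divergent_terms n d l eps))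
    /\ filterlim c (at_right 0) (locally v).

Definition is_finite_part_infty (f : R -> R) (m : nat) (v : R) : Prop :=
  exists F : R -> R,
    (forall a : R, 0 < a -> is_finite_part f m a (F a))
    /\ is_lim F p_infty v.

Definition ex_finite_part_infty (f : R -> R) (m : nat) : Prop :=
  exists v : R, is_finite_part_infty f m v.

Definition finite_part_infty (f : R -> R) (m : nat) : R :=
  iota (is_finite_part_infty f m).

Definition stieltjes_integrand (rho : R -> R) (beta : R) (x : R) : R :=
  rho x / (1 / beta + x ^ 2).

Definition mu_neg (rho : R -> R) (k : nat) : R :=
  finite_part_infty rho (2 * k + 2).

Definition stieltjes_Delta (rhoC : C -> C) (beta : R) : C :=
  (RtoC (PI * sqrt beta / 4)
     * (rhoC (Ci / RtoC (sqrt beta)) + rhoC (- Ci / RtoC (sqrt beta)))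
   + RtoC (sqrt beta * ln beta) / (RtoC 4 * Ci)
     * (rhoC (Ci / RtoC (sqrt beta)) - rhoC (- Ci / RtoC (sqrt beta))))%C.

(* Main.v *)
Require Import Defs.
From Stdlib Require Import Reals Lra Lia Psatz ClassicalEpsilon.
From Coquelicot Require Import Coquelicot.

Open Scope R_scope.

(** Put b = 1 / sqrt beta and cut the integral at some x0 > b.

    Beyond x0, expanding 1 / (b^2 + x^2) in powers of b^2 / x^2 gives the tails of the moments;
    convergence is only conditional, and the remainder is controlled by integrating by parts
    against the bounded primitive of rho(x) / x^2.

    On [0, x0], rho is a power series sum_n a_n x^n and everything is linear in the a_n.  For the
    monomial x^n, the integral of x^n / (b^2 + x^2) minus the n-th contribution to Delta minus the
    first K finite parts is a remainder R(n, K) satisfying R(n+2, K+1) = - b^2 R(n, K).  So one only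
    needs n = 0 and n = 1, which are the Taylor remainders of atan and ln (1 + y^2) / 2 at
    y = b / x0; hence |R(n, K)| <= C x0^n (b / x0)^(2 K), which sums over n.

    The power series comes from Goursat's subdivision argument applied directly to the form
    f(w) dw / (w - z0) pulled back to the cone from z0 onto a circle: it is closed, so its integral
    over the circle is the limit of its integral over the shrunken circles, that is, f(z0) times a
    constant. *)

(** [entire] provides a derivative at each point but says nothing of its continuity, so Green's
    formula cannot show that the form is closed; subdivision replaces it. A complex power series is
    needed because the same a_n must describe rho near 0 on the real line and at the two points i b
    and - i b.

    The k-th moment is the finite part on [0, x0] plus an ordinary improper integral beyond x0, so
    the limit a -> oo in its definition is taken for each k separately. The ratio (b / x0)^2 < 1
    then governs both head and tail, whence a cut beyond b.

    Delta is what the finite parts miss. For n = 0, atan (a / b) = PI / 2 - atan (b / a) leaves the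
    constant PI / (2 b); for n = 1, the integral ln (b^2 + a^2) / 2 - ln b leaves - ln b once the
    finite part ln a is removed, and this is the origin of ln beta.

    [finite_part_infty] is an [iota], so computing it requires uniqueness: a combination of inverse
    powers and a logarithm that converges at 0 must have limit 0. *)

(** * Goursat subdivision *)

(* [ring] and [field] do not see through the carrier projections of Coquelicot's structures. *)
Ltac at_type T := match goal with |- @eq _ ?u ?v => change (@eq T u v) end.

(** Stated for an abstract [J] because the rectangle will lie in the parameters of a cone, not in
    the plane of the form. If the value were nonzero, some quarter at every stage would exceed [eps]
    times its squared half-perimeter; these quarters shrink to a point where the local bound says
    the opposite. *)
Lemma additive_rectangle_zero (J : R -> R -> R -> R -> C) (a b c d : R) :
  a <= b -> c <= d ->
  (forall x1 x2 x3 y1 y2, a <= x1 -> x1 <= x2 -> x2 <= x3 -> x3 <= b ->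
     c <= y1 -> y1 <= y2 -> y2 <= d ->
     J x1 x3 y1 y2 = (J x1 x2 y1 y2 + J x2 x3 y1 y2)%C) ->
  (forall x1 x2 y1 y2 y3, a <= x1 -> x1 <= x2 -> x2 <= b ->
     c <= y1 -> y1 <= y2 -> y2 <= y3 -> y3 <= d ->
     J x1 x2 y1 y3 = (J x1 x2 y1 y2 + J x1 x2 y2 y3)%C) ->
  (forall x y eps, a <= x <= b -> c <= y <= d -> 0 < eps ->
     exists del, 0 < del /\ forall x1 x2 y1 y2,
       a <= x1 <= x -> x <= x2 <= b -> c <= y1 <= y -> y <= y2 <= d ->
       x2 - x1 < del -> y2 - y1 < del ->
       Cmod (J x1 x2 y1 y2) <= eps * ((x2 - x1) + (y2 - y1)) ^ 2) ->
  J a b c d = 0%C.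
Proof.
intros Hab Hcd Hx Hy Hloc.
apply Cmod_eq_0.
destruct (Rle_lt_or_eq_dec 0 _ (Cmod_ge_0 (J a b c d))) as [Hpos|<-]; [exfalso|easy].
set (p := b - a). set (q := d - c).
(* The [+ 1] covers a rectangle reduced to a point and makes [Hbig] strict. *)
set (eps := Cmod (J a b c d) / (2 * ((p + q) ^ 2 + 1))).
assert (Hden : 0 < 2 * ((p + q) ^ 2 + 1)) by (pose proof (pow2_ge_0 (p + q)); lra).
assert (Heps : 0 < eps) by (apply Rdiv_lt_0_compat; lra).
assert (Hbig : eps * (p + q) ^ 2 < Cmod (J a b c d)).
{ pose proof (pow2_ge_0 (p + q)) as Hsq. assert (He : eps * (2 * ((p + q) ^ 2 + 1)) = Cmod (J a b c d)) by (unfold eps; field; lra).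
  rewrite <- He. apply Rmult_lt_compat_l; lra. }
set (h := fun n => (/ 2) ^ n).
assert (Hh : forall n, 0 < h n) by (intro n; apply pow_lt; lra).
assert (HhS : forall n, h n = 2 * h (S n)) by (intro n; unfold h; simpl; field).
pose (bad := fun n (s : R * R) =>
  a <= fst s /\ fst s + p * h n <= b /\ c <= snd s /\ snd s + q * h n <= d /\
  eps * ((p + q) * h n) ^ 2 <
  Cmod (J (fst s) (fst s + p * h n) (snd s) (snd s + q * h n))).
assert (Hp : 0 <= p) by (unfold p; lra). assert (Hq : 0 <= q) by (unfold q; lra).
assert (Hstep : forall n s, bad n s -> exists s', bad (S n) s' /\
   fst s <= fst s' /\ fst s' + p * h (S n) <= fst s + p * h n /\
   snd s <= snd s' /\ snd s' + q * h (S n) <= snd s + q * h n).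
{ intros n [x y] (H1 & H2 & H3 & H4 & H5). simpl in *.
  pose proof (Hh (S n)) as Hn. rewrite (HhS n) in *.
  set (e := h (S n)) in *.
  assert (0 <= p * e) by nra. assert (0 <= q * e) by nra.
  rewrite (Hx x (x + p * e) (x + p * (2 * e))) in H5 by lra.
  rewrite (Hy x (x + p * e) y (y + q * e)) in H5 by lra.
  rewrite (Hy (x + p * e) (x + p * (2 * e)) y (y + q * e)) in H5 by lra.
  (* If all four quarters obeyed the bound, the triangle inequality would give the parent four times
     it, which is exactly the bound that the parent violates. *)
  assert (Hc : exists x' y', (x' = x \/ x' = x + p * e) /\ (y' = y \/ y' = y + q * e) /\
     eps * ((p + q) * e) ^ 2 < Cmod (J x' (x' + p * e) y' (y' + q * e))).
  { apply NNPP. intro Hn'.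
    assert (Hall : forall x' y', (x' = x \/ x' = x + p * e) -> (y' = y \/ y' = y + q * e) ->
      Cmod (J x' (x' + p * e) y' (y' + q * e)) <= eps * ((p + q) * e) ^ 2).
    { intros x' y' Hx' Hy'. apply Rnot_lt_le. intro. apply Hn'. exists x', y'. auto. }
    pose proof (Hall x y (or_introl eq_refl) (or_introl eq_refl)) as Q1.
    pose proof (Hall x _ (or_introl eq_refl) (or_intror eq_refl)) as Q2.
    pose proof (Hall _ y (or_intror eq_refl) (or_introl eq_refl)) as Q3.
    pose proof (Hall _ _ (or_intror eq_refl) (or_intror eq_refl)) as Q4.
    replace (x + p * e + p * e) with (x + p * (2 * e)) in * by ring.
    replace (y + q * e + q * e) with (y + q * (2 * e)) in * by ring.
    pose proof (Cmod_triangle (J x (x + p * e) y (y + q * e) + J x (x + p * e) (y + q * e) (y + q * (2 * e)))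
      (J (x + p * e) (x + p * (2 * e)) y (y + q * e) + J (x + p * e) (x + p * (2 * e)) (y + q * e) (y + q * (2 * e)))) as T.
    pose proof (Cmod_triangle (J x (x + p * e) y (y + q * e)) (J x (x + p * e) (y + q * e) (y + q * (2 * e)))) as T1.
    pose proof (Cmod_triangle (J (x + p * e) (x + p * (2 * e)) y (y + q * e)) (J (x + p * e) (x + p * (2 * e)) (y + q * e) (y + q * (2 * e)))) as T2.
    replace (eps * ((p + q) * (2 * e)) ^ 2) with (4 * (eps * ((p + q) * e) ^ 2)) in H5 by ring.
    lra. }
  destruct Hc as (x' & y' & Hx' & Hy' & Hbad).
  exists (x', y'). unfold bad. simpl. fold e.
  repeat split; try assumption; destruct Hx' as [-> | ->]; destruct Hy' as [-> | ->]; lra. }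
assert (H0 : bad 0%nat (a, c)).
{ unfold bad, h; simpl. rewrite !Rmult_1_r.
  replace (a + p) with b by (unfold p; ring). replace (c + q) with d by (unfold q; ring).
  simpl in Hbig. rewrite Rmult_1_r in Hbig. repeat split; try lra. }
(* Dependent choice: [u] carries the proof of [bad] along, since [Hstep] needs it to supply the next
   corner. *)
pose (next := fun n (s : {s | bad n s}) =>
  constructive_indefinite_description _ (Hstep n (proj1_sig s) (proj2_sig s))).
pose (u := fix u n : {s | bad n s} := match n with
  | O => exist _ _ H0
  | S m => exist _ (proj1_sig (next m (u m))) (proj1 (proj2_sig (next m (u m)))) end).
set (X := fun n => fst (proj1_sig (u n))). set (Y := fun n => snd (proj1_sig (u n))).
assert (Hu : forall n, bad n (X n, Y n)).
{ intro n. unfold X, Y. rewrite <- surjective_pairing. apply (proj2_sig (u n)). }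
assert (HS : forall n, X n <= X (S n) /\ X (S n) + p * h (S n) <= X n + p * h n /\
   Y n <= Y (S n) /\ Y (S n) + q * h (S n) <= Y n + q * h n).
{ intro n. exact (proj2 (proj2_sig (next n (u n)))). }
(* Nested intervals: the left ends increase to a limit, which stays below every right end because
   the right ends decrease. *)
assert (Hlim : forall (Z : nat -> R) r B, 0 <= r -> (forall n, Z n <= Z (S n)) ->
  (forall n, Z (S n) + r * h (S n) <= Z n + r * h n) -> (forall n, Z n <= B) ->
  exists l, forall n, Z n <= l <= Z n + r * h n).
{ intros Z r B Hr Hi Hd HB.
  destruct (ex_finite_lim_seq_incr Z B Hi HB) as [l Hl].
  exists l. intro n. split.
  - exact (is_lim_seq_incr_compare Z l Hl Hi n).
  - assert (Hdec : forall m, Z (n + m)%nat + r * h (n + m)%nat <= Z n + r * h n).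
    { induction m as [|m IH]; [rewrite Nat.add_0_r; lra|].
      rewrite Nat.add_succ_r. specialize (Hd (n + m)%nat). lra. }
    apply (is_lim_seq_le (fun m => Z (n + m)%nat) (fun _ => Z n + r * h n) l (Z n + r * h n)).
    + intro m. specialize (Hdec m). pose proof (Hh (n + m)%nat). nra.
    + apply (is_lim_seq_ext (fun m => Z (m + n)%nat)); [intro; f_equal; lia|].
      apply -> (is_lim_seq_incr_n Z n l). exact Hl.
    + apply is_lim_seq_const. }
destruct (Hlim X p b Hp) as [x Hxl];
  [intro n; apply HS | intro n; apply HS |
   intro n; destruct (Hu n) as (_ & H & _); simpl in H; pose proof (Hh n); nra | ].
destruct (Hlim Y q d Hq) as [y Hyl];
  [intro n; apply HS | intro n; apply HS |
   intro n; destruct (Hu n) as (_ & _ & _ & H & _); simpl in H; pose proof (Hh n); nra | ].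
assert (Hxr : a <= x <= b).
{ destruct (Hu 0%nat) as (A1 & A2 & _). simpl in A1, A2. specialize (Hxl 0%nat). lra. }
assert (Hyr : c <= y <= d).
{ destruct (Hu 0%nat) as (_ & _ & A1 & A2 & _). simpl in A1, A2. specialize (Hyl 0%nat). lra. }
destruct (Hloc x y eps Hxr Hyr Heps) as (del & Hdel & Hsm).
destruct (pow_lt_1_zero (/ 2)) with (y := del / (p + q + 1)) as [N HN].
{ rewrite Rabs_pos_eq; lra. }
{ apply Rdiv_lt_0_compat; lra. }
specialize (HN N (le_n _)). rewrite Rabs_pos_eq in HN by (left; apply Hh). fold (h N) in HN.
assert (Hlt : (p + q + 1) * h N < del).
{ replace del with ((p + q + 1) * (del / (p + q + 1))) by (field; lra).
  apply Rmult_lt_compat_l; lra. }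
pose proof (Hh N) as HhN.
destruct (Hu N) as (A1 & A2 & A3 & A4 & A5). simpl in A1, A2, A3, A4, A5.
specialize (Hxl N). specialize (Hyl N).
assert (Hf := Hsm (X N) (X N + p * h N) (Y N) (Y N + q * h N)).
assert (Cmod (J (X N) (X N + p * h N) (Y N) (Y N + q * h N)) <= eps * ((p + q) * h N) ^ 2).
{ replace ((p + q) * h N) with (X N + p * h N - X N + (Y N + q * h N - Y N)) by ring.
  apply Hf; try lra; nra. }
simpl in H. lra.
Qed.

(** * Integration and differentiation of complex-valued functions *)

Notation is_CInt := (is_RInt (V := C_R_NormedModule)).
Notation CInt := (RInt (V := C_R_CompleteNormedModule)).

(** Done on real and imaginary parts, since [C_R_NormedModule] has only real scalars. *)
Lemma is_CInt_mult_l (c : C) (f : R -> C) (a b : R) (l : C) :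
  is_CInt f a b l -> is_CInt (fun t => c * f t)%C a b (c * l)%C.
Proof.
intros H.
pose proof (is_RInt_fct_extend_fst (U := R_NormedModule) (V := R_NormedModule) _ _ _ _ H) as H1.
pose proof (is_RInt_fct_extend_snd (U := R_NormedModule) (V := R_NormedModule) _ _ _ _ H) as H2.
apply (is_RInt_fct_extend_pair (U := R_NormedModule) (V := R_NormedModule)).
- exact (is_RInt_minus _ _ _ _ _ _ (is_RInt_scal _ _ _ (fst c) _ H1)
    (is_RInt_scal _ _ _ (snd c) _ H2)).
- exact (is_RInt_plus _ _ _ _ _ _ (is_RInt_scal _ _ _ (fst c) _ H2)
    (is_RInt_scal _ _ _ (snd c) _ H1)).
Qed.

Lemma is_CInt_minus (f g : R -> C) (a b : R) (lf lg : C) :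
  is_CInt f a b lf -> is_CInt g a b lg -> is_CInt (fun t => f t - g t)%C a b (lf - lg)%C.
Proof. exact (is_RInt_minus (V := C_R_NormedModule) f g a b lf lg). Qed.

Lemma is_CInt_plus (f g : R -> C) (a b : R) (lf lg : C) :
  is_CInt f a b lf -> is_CInt g a b lg -> is_CInt (fun t => f t + g t)%C a b (lf + lg)%C.
Proof. exact (is_RInt_plus (V := C_R_NormedModule) f g a b lf lg). Qed.

Lemma is_CInt_const (c : C) (a b : R) : is_CInt (fun _ => c) a b (RtoC (b - a) * c)%C.
Proof.
replace (RtoC (b - a) * c)%C with (scal (V := C_R_NormedModule) (b - a) c).
- apply is_RInt_const.
- destruct c as [x y]. unfold RtoC, Cmult, scal; simpl; unfold prod_scal; simpl.
  unfold scal; simpl; unfold mult; simpl. f_equal; ring.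
Qed.

Lemma is_CInt_bound (f : R -> C) (a b M : R) (l : C) :
  a <= b -> (forall t, a <= t <= b -> Cmod (f t) <= M) -> is_CInt f a b l ->
  Cmod l <= (b - a) * M.
Proof.
intros Hab Hf Hi. rewrite Cmod_norm.
apply (norm_RInt_le_const (V := C_R_NormedModule) f a b l M Hab); [|exact Hi].
intros x Hx. rewrite <- Cmod_norm. now apply Hf.
Qed.

Lemma CInt_correct (f : R -> C) (a b : R) :
  (forall t, Rmin a b <= t <= Rmax a b -> continuous (T := R_UniformSpace) (U := C_UniformSpace) f t) ->
  is_CInt f a b (CInt f a b).
Proof.
intros H. apply (RInt_correct (V := C_R_CompleteNormedModule)).
apply (ex_RInt_continuous (V := C_R_CompleteNormedModule)). exact H.
Qed.

Lemma Ccontinuous_pair {U : UniformSpace} (u v : U -> R) (x : U) :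
  continuous u x -> continuous v x ->
  continuous (U := C_UniformSpace) (fun y => (u y, v y)) x.
Proof.
intros Hu Hv.
apply (continuous_comp_2 (U := U) (V := R_UniformSpace) (W := R_UniformSpace) (X := C_UniformSpace)
  u v (fun a b => (a, b)) x Hu Hv).
apply continuous_ext with (f := fun z : C_UniformSpace => z).
- intros [a b]; reflexivity.
- apply continuous_id.
Qed.

Lemma Ccontinuous_fst {U : UniformSpace} (f : U -> C) (x : U) :
  continuous (U := C_UniformSpace) f x -> continuous (fun y => fst (f y)) x.
Proof.
intros H. apply (continuous_comp (V := C_UniformSpace) f (fun z => fst z) x H). apply continuous_fst.
Qed.

Lemma Ccontinuous_snd {U : UniformSpace} (f : U -> C) (x : U) :
  continuous (U := C_UniformSpace) f x -> continuous (fun y => snd (f y)) x.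
Proof.
intros H. apply (continuous_comp (V := C_UniformSpace) f (fun z => snd z) x H). apply continuous_snd.
Qed.

Lemma Ccontinuous_mult {U : UniformSpace} (f g : U -> C) (x : U) :
  continuous (U := C_UniformSpace) f x -> continuous (U := C_UniformSpace) g x ->
  continuous (U := C_UniformSpace) (fun y => f y * g y)%C x.
Proof.
intros Hf Hg.
pose proof (Ccontinuous_fst _ _ Hf). pose proof (Ccontinuous_snd _ _ Hf).
pose proof (Ccontinuous_fst _ _ Hg). pose proof (Ccontinuous_snd _ _ Hg).
apply Ccontinuous_pair.
- apply (continuous_minus (K := R_AbsRing) (V := R_NormedModule)); now apply (continuous_mult (K := R_AbsRing)).
- apply (continuous_plus (K := R_AbsRing) (V := R_NormedModule)); now apply (continuous_mult (K := R_AbsRing)).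
Qed.

Lemma Ccontinuous_plus {U : UniformSpace} (f g : U -> C) (x : U) :
  continuous (U := C_UniformSpace) f x -> continuous (U := C_UniformSpace) g x ->
  continuous (U := C_UniformSpace) (fun y => f y + g y)%C x.
Proof. apply (continuous_plus (V := C_R_NormedModule)). Qed.

Lemma Ccontinuous_minus {U : UniformSpace} (f g : U -> C) (x : U) :
  continuous (U := C_UniformSpace) f x -> continuous (U := C_UniformSpace) g x ->
  continuous (U := C_UniformSpace) (fun y => f y - g y)%C x.
Proof. apply (continuous_minus (V := C_R_NormedModule)). Qed.

Lemma Ccontinuous_RtoC {U : UniformSpace} (f : U -> R) (x : U) :
  continuous f x -> continuous (U := C_UniformSpace) (fun y => RtoC (f y)) x.
Proof. intros H. apply Ccontinuous_pair; [exact H|apply continuous_const]. Qed.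

Lemma Ccontinuous_inv {U : UniformSpace} (f : U -> C) (x : U) :
  continuous (U := C_UniformSpace) f x -> f x <> 0%C ->
  continuous (U := C_UniformSpace) (fun y => / f y)%C x.
Proof.
intros Hf H0.
pose proof (Ccontinuous_fst _ _ Hf) as H1. pose proof (Ccontinuous_snd _ _ Hf) as H2.
set (N := fun y => fst (f y) ^ 2 + snd (f y) ^ 2).
assert (HN : continuous (fun y => / N y) x).
{ apply (continuous_comp (V := R_UniformSpace) N Rinv).
  - unfold N. simpl. apply (continuous_plus (K := R_AbsRing) (V := R_NormedModule)).
    + apply (continuous_mult (K := R_AbsRing)); [exact H1|].
      apply (continuous_mult (K := R_AbsRing)); [exact H1|apply continuous_const].
    + apply (continuous_mult (K := R_AbsRing)); [exact H2|].
      apply (continuous_mult (K := R_AbsRing)); [exact H2|apply continuous_const].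
  - apply continuous_Rinv. unfold N. intro E. apply H0.
    destruct (f x) as [u v]. simpl in E. apply injective_projections; simpl; nra. }
apply Ccontinuous_pair.
- apply (continuous_mult (K := R_AbsRing)); [exact H1|exact HN].
- apply (continuous_mult (K := R_AbsRing)); [|exact HN].
  apply (continuous_opp (K := R_AbsRing) (V := R_NormedModule)). exact H2.
Qed.

Lemma ex_derive_C_eps (f : C -> C) (z : C) :
  ex_derive (K := C_AbsRing) (V := C_NormedModule) f z ->
  exists d : C, forall eps, 0 < eps -> exists del, 0 < del /\
    forall w, Cmod (w - z) < del -> Cmod (f w - f z - (w - z) * d) <= eps * Cmod (w - z).
Proof.
intros [d [_ Hd]]. exists d. intros eps Heps.
specialize (Hd z (fun P H => H) (mkposreal eps Heps)).
destruct Hd as [del Hdel]. exists del. split; [apply cond_pos|].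
intros w Hw. exact (Hdel w Hw).
Qed.

Lemma entire_eps_delta (f : C -> C) : entire f -> forall z eps, 0 < eps ->
  exists del, 0 < del /\ forall w, Cmod (w - z) < del -> Cmod (f w - f z) < eps.
Proof.
intros Hf z eps Heps.
destruct (ex_derive_C_eps f z (Hf z)) as [d Hd].
destruct (Hd 1 Rlt_0_1) as (del & Hdel & H).
pose proof (Cmod_ge_0 d).
exists (Rmin del (eps / (Cmod d + 2))). split.
{ apply Rmin_glb_lt; [easy|apply Rdiv_lt_0_compat; lra]. }
intros w Hw. pose proof (Rmin_l del (eps / (Cmod d + 2))). pose proof (Rmin_r del (eps / (Cmod d + 2))).
specialize (H w ltac:(lra)).
replace (f w - f z)%C with ((f w - f z - (w - z) * d) + (w - z) * d)%C by ring.
eapply Rle_lt_trans; [apply Cmod_triangle|]. rewrite Cmod_mult.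
assert (Cmod (w - z) * (Cmod d + 2) < eps).
{ replace eps with (eps / (Cmod d + 2) * (Cmod d + 2)) by (field; lra).
  apply Rmult_lt_compat_r; lra. }
pose proof (Cmod_ge_0 (w - z)). nra.
Qed.

Lemma entire_continuous (f : C -> C) (z : C) : entire f ->
  continuous (T := C_UniformSpace) (U := C_UniformSpace) f z.
Proof.
intros Hf.
apply filterlim_locally. intros eps.
destruct (entire_eps_delta f Hf z eps (cond_pos eps)) as (del & Hdel & H).
(* Balls of [C_UniformSpace] are balls for the larger of the two coordinate distances, which
   controls [Cmod] up to the factor sqrt 2. *)
assert (Hd2 : 0 < del / sqrt 2) by (apply Rdiv_lt_0_compat; [easy|apply Rlt_sqrt2_0]).
exists (mkposreal _ Hd2). intros w Hw.
apply C_NormedModule_mixin_compat2 in Hw. simpl in Hw.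
replace (sqrt 2 * (del / sqrt 2)) with del in Hw by (field; apply Rgt_not_eq, Rlt_sqrt2_0).
apply C_NormedModule_mixin_compat1. apply H. exact Hw.
Qed.

(** * Circles, and the cone from a point onto a circle *)

Definition circ (r th : R) : C := (r * cos th, r * sin th).

Lemma Cmod_le_sum (x y : R) : Cmod (x, y) <= Rabs x + Rabs y.
Proof.
replace (x, y) with (RtoC x + Ci * RtoC y)%C.
- eapply Rle_trans; [apply Cmod_triangle|].
  rewrite Cmod_mult, Cmod_Ci, !Cmod_R. lra.
- unfold RtoC, Ci, Cplus, Cmult; simpl. f_equal; ring.
Qed.

Lemma Cmod_circ (r th : R) : 0 <= r -> Cmod (circ r th) = r.
Proof.
intros Hr. unfold circ, Cmod; simpl.
replace (r * cos th * (r * cos th * 1) + r * sin th * (r * sin th * 1)) with (r * r * (Rsqr (sin th) + Rsqr (cos th)))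
  by (unfold Rsqr; ring).
rewrite sin2_cos2, Rmult_1_r. now apply sqrt_square.
Qed.

Lemma cos_sin_lipschitz (x y : R) :
  Rabs (cos x - cos y) <= Rabs (x - y) /\ Rabs (sin x - sin y) <= Rabs (x - y).
Proof.
split.
- destruct (MVT_gen cos y x (fun t => - sin t)) as (c & _ & ->).
  + intros; auto_derive; [easy|ring].
  + intros. apply continuity_cos.
  + rewrite Rabs_mult, Rabs_Ropp. rewrite <- (Rmult_1_l (Rabs (x - y))) at 2.
    apply Rmult_le_compat_r; [apply Rabs_pos|]. apply Rabs_le, SIN_bound.
- destruct (MVT_gen sin y x cos) as (c & _ & ->).
  + intros; auto_derive; [easy|ring].
  + intros. apply continuity_sin.
  + rewrite Rabs_mult. rewrite <- (Rmult_1_l (Rabs (x - y))) at 2.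
    apply Rmult_le_compat_r; [apply Rabs_pos|]. apply Rabs_le, COS_bound.
Qed.

Lemma circ_lipschitz (r x y : R) : 0 <= r -> Cmod (circ r x - circ r y) <= 2 * r * Rabs (x - y).
Proof.
intros Hr.
replace (circ r x - circ r y)%C with (r * (cos x - cos y), r * (sin x - sin y))
  by (unfold circ, Cminus, Cplus, Copp; simpl; f_equal; ring).
eapply Rle_trans; [apply Cmod_le_sum|].
rewrite !Rabs_mult, (Rabs_pos_eq r Hr).
destruct (cos_sin_lipschitz x y). nra.
Qed.

Lemma Ccontinuous_circ (r th : R) : continuous (U := C_UniformSpace) (circ r) th.
Proof.
apply Ccontinuous_pair; apply (continuous_mult (K := R_AbsRing)); try apply continuous_const.
- apply continuity_pt_filterlim, continuity_cos.
- apply continuity_pt_filterlim, continuity_sin.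
Qed.

Lemma is_CInt_circ (r a b : R) :
  is_CInt (circ r) a b (- Ci * (circ r b - circ r a))%C.
Proof.
replace (- Ci * (circ r b - circ r a))%C with ((r * sin b - r * sin a, - r * cos b - - r * cos a) : C)
  by (unfold circ, Ci, Cminus, Cplus, Copp, Cmult; simpl; f_equal; ring).
apply (is_RInt_fct_extend_pair (U := R_NormedModule) (V := R_NormedModule)).
- apply (is_RInt_derive (V := R_CompleteNormedModule) (fun t => r * sin t) (fun t => r * cos t)).
  + intros. auto_derive; [easy|ring].
  + intros. exact (Ccontinuous_fst _ _ (Ccontinuous_circ r x)).
- apply (is_RInt_derive (V := R_CompleteNormedModule) (fun t => - r * cos t) (fun t => r * sin t)).
  + intros. auto_derive; [easy|ring].
  + intros. exact (Ccontinuous_snd _ _ (Ccontinuous_circ r x)).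
Qed.

(** The segment from [z0] at t = 0 to the circle at t = 1. Along it w - z0 = t (circ r th - z0), so
    dw / (w - z0) pulls back to dt / t + i [cauchy_weight] dth: each coefficient depends on one
    parameter only, and the angular one is the same on every shrunken circle. *)
Definition cone (z0 : C) (r t th : R) : C := (z0 + RtoC t * (circ r th - z0))%C.

Definition cauchy_weight (z0 : C) (r th : R) : C := (circ r th / (circ r th - z0))%C.

Lemma circ_sub_lower (z0 : C) (r th : R) : Cmod z0 < r -> r - Cmod z0 <= Cmod (circ r th - z0).
Proof.
intros H. pose proof (Cmod_ge_0 z0).
pose proof (Cmod_triangle (circ r th - z0) z0) as T.
replace (circ r th - z0 + z0)%C with (circ r th) in T by ring.
rewrite Cmod_circ in T by lra. lra.
Qed.

Lemma circ_sub_neq0 (z0 : C) (r th : R) : Cmod z0 < r -> (circ r th - z0)%C <> 0%C.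
Proof.
intros H E. pose proof (circ_sub_lower z0 r th H). rewrite E, Cmod_0 in H0. lra.
Qed.

Lemma cauchy_weight_bound (z0 : C) (r th : R) : Cmod z0 < r ->
  Cmod (cauchy_weight z0 r th) <= r / (r - Cmod z0).
Proof.
intros H. unfold cauchy_weight. pose proof (Cmod_ge_0 z0).
rewrite Cmod_div by now apply circ_sub_neq0.
rewrite Cmod_circ by lra. apply Rmult_le_compat_l; [lra|].
apply Rinv_le_contravar; [lra|]. now apply circ_sub_lower.
Qed.

Lemma Ccontinuous_cauchy_weight (z0 : C) (r th : R) : Cmod z0 < r ->
  continuous (U := C_UniformSpace) (cauchy_weight z0 r) th.
Proof.
intros H. apply Ccontinuous_mult; [apply Ccontinuous_circ|].
apply (Ccontinuous_inv (fun th => circ r th - z0)%C).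
- apply Ccontinuous_minus; [apply Ccontinuous_circ|apply continuous_const].
- now apply circ_sub_neq0.
Qed.

Lemma Ccontinuous_entire_comp {U : UniformSpace} (f : C -> C) (h : U -> C) (x : U) : entire f ->
  continuous (U := C_UniformSpace) h x -> continuous (U := C_UniformSpace) (fun y => f (h y)) x.
Proof.
intros Hf Hh. apply (continuous_comp (V := C_UniformSpace) (W := C_UniformSpace) h f x Hh).
now apply entire_continuous.
Qed.

Lemma Ccontinuous_cone_l (z0 : C) (r t th : R) :
  continuous (U := C_UniformSpace) (fun t => cone z0 r t th) t.
Proof.
apply Ccontinuous_plus; [apply continuous_const|].
apply Ccontinuous_mult; [apply Ccontinuous_RtoC, continuous_id|apply continuous_const].
Qed.

Lemma Ccontinuous_cone_r (z0 : C) (r t th : R) :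
  continuous (U := C_UniformSpace) (cone z0 r t) th.
Proof.
apply Ccontinuous_plus; [apply continuous_const|].
apply Ccontinuous_mult; [apply continuous_const|].
apply Ccontinuous_minus; [apply Ccontinuous_circ|apply continuous_const].
Qed.

Lemma cone_lipschitz (z0 : C) (r t t' th th' : R) : 0 <= r -> 0 <= t' <= 1 ->
  Cmod (cone z0 r t th - cone z0 r t' th') <= (2 * r + Cmod z0) * (Rabs (t - t') + Rabs (th - th')).
Proof.
intros Hr Ht.
replace (cone z0 r t th - cone z0 r t' th')%C with
  (RtoC (t - t') * (circ r th - z0) + RtoC t' * (circ r th - circ r th'))%C
  by (unfold cone; rewrite RtoC_minus; ring).
eapply Rle_trans; [apply Cmod_triangle|].
rewrite !Cmod_mult, !Cmod_R, (Rabs_pos_eq t') by lra.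
pose proof (circ_lipschitz r th th' Hr).
assert (Cmod (circ r th - z0) <= r + Cmod z0).
{ replace (circ r th - z0)%C with (circ r th + - z0)%C by ring.
  eapply Rle_trans; [apply Cmod_triangle|]. rewrite Cmod_opp, Cmod_circ; lra. }
pose proof (Rabs_pos (t - t')). pose proof (Rabs_pos (th - th')). pose proof (Cmod_ge_0 z0).
pose proof (Cmod_ge_0 (circ r th - z0)). pose proof (Cmod_ge_0 (circ r th - circ r th')).
assert (Rabs (t - t') * Cmod (circ r th - z0) <= Rabs (t - t') * (r + Cmod z0)) by (apply Rmult_le_compat_l; lra).
assert (t' * Cmod (circ r th - circ r th') <= 2 * r * Rabs (th - th')) by nra.
nra.
Qed.

(** * Cauchy's formula for a circle *)

Definition cone_side (f : C -> C) (z0 : C) (r th1 th2 t : R) : C :=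
  (RtoC (/ t) * (f (cone z0 r t th1) - f (cone z0 r t th2)))%C.

Definition cone_arc (f : C -> C) (z0 : C) (r t1 t2 th : R) : C :=
  ((f (cone z0 r t2 th) - f (cone z0 r t1 th)) * cauchy_weight z0 r th)%C.

(** The integral of f(w) dw / (w - z0) along the counterclockwise boundary of the cell in the (t,
    th) plane; opposite edges are merged into one integral of a difference. *)
Definition cone_boundary (f : C -> C) (z0 : C) (r t1 t2 th1 th2 : R) : C :=
  (CInt (cone_side f z0 r th1 th2) t1 t2 + Ci * CInt (cone_arc f z0 r t1 t2) th1 th2)%C.

Lemma is_CInt_cone_side f z0 r th1 th2 t1 t2 : entire f -> 0 < t1 -> t1 <= t2 ->
  is_CInt (cone_side f z0 r th1 th2) t1 t2 (CInt (cone_side f z0 r th1 th2) t1 t2).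
Proof.
intros Hf H1 H2. apply CInt_correct. rewrite Rmin_left, Rmax_right by lra. intros t Ht.
apply Ccontinuous_mult.
- apply Ccontinuous_RtoC, continuous_Rinv. lra.
- apply Ccontinuous_minus; (apply Ccontinuous_entire_comp; [easy|apply Ccontinuous_cone_l]).
Qed.

Lemma is_CInt_cone_arc f z0 r t1 t2 th1 th2 : entire f -> Cmod z0 < r ->
  is_CInt (cone_arc f z0 r t1 t2) th1 th2 (CInt (cone_arc f z0 r t1 t2) th1 th2).
Proof.
intros Hf Hr. apply CInt_correct. intros th _.
apply Ccontinuous_mult; [|now apply Ccontinuous_cauchy_weight].
apply Ccontinuous_minus; (apply Ccontinuous_entire_comp; [easy|apply Ccontinuous_cone_r]).
Qed.

Lemma is_CInt_unique (f : R -> C) (a b : R) (l : C) : is_CInt f a b l -> CInt f a b = l.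
Proof. exact (is_RInt_unique (V := C_R_CompleteNormedModule) f a b l). Qed.

Lemma cone_boundary_add_t f z0 r x1 x2 x3 y1 y2 : entire f -> Cmod z0 < r ->
  0 < x1 -> x1 <= x2 -> x2 <= x3 ->
  cone_boundary f z0 r x1 x3 y1 y2 =
  (cone_boundary f z0 r x1 x2 y1 y2 + cone_boundary f z0 r x2 x3 y1 y2)%C.
Proof.
intros Hf Hr H1 H2 H3. unfold cone_boundary.
pose proof (is_RInt_Chasles (V := C_R_NormedModule) _ _ _ _ _ _
  (is_CInt_cone_side f z0 r y1 y2 x1 x2 Hf H1 H2)
  (is_CInt_cone_side f z0 r y1 y2 x2 x3 Hf ltac:(lra) H3)) as E1.
rewrite (is_CInt_unique _ _ _ _ E1).
pose proof (is_CInt_plus _ _ _ _ _ _ (is_CInt_cone_arc f z0 r x1 x2 y1 y2 Hf Hr)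
  (is_CInt_cone_arc f z0 r x2 x3 y1 y2 Hf Hr)) as E2.
apply (is_RInt_ext (V := C_R_NormedModule) _ (cone_arc f z0 r x1 x3)) in E2.
2: { intros x _. unfold cone_arc. at_type C. ring. }
rewrite (is_CInt_unique _ _ _ _ E2).
change plus with Cplus. ring.
Qed.

Lemma cone_boundary_add_th f z0 r x1 x2 y1 y2 y3 : entire f -> Cmod z0 < r ->
  0 < x1 -> x1 <= x2 ->
  cone_boundary f z0 r x1 x2 y1 y3 =
  (cone_boundary f z0 r x1 x2 y1 y2 + cone_boundary f z0 r x1 x2 y2 y3)%C.
Proof.
intros Hf Hr H1 H2. unfold cone_boundary.
pose proof (is_RInt_Chasles (V := C_R_NormedModule) _ _ _ _ _ _
  (is_CInt_cone_arc f z0 r x1 x2 y1 y2 Hf Hr)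
  (is_CInt_cone_arc f z0 r x1 x2 y2 y3 Hf Hr)) as E1.
rewrite (is_CInt_unique _ _ _ _ E1).
pose proof (is_CInt_plus _ _ _ _ _ _ (is_CInt_cone_side f z0 r y1 y2 x1 x2 Hf H1 H2)
  (is_CInt_cone_side f z0 r y2 y3 x1 x2 Hf H1 H2)) as E2.
apply (is_RInt_ext (V := C_R_NormedModule) _ (cone_side f z0 r y1 y3)) in E2.
2: { intros x _. unfold cone_side. at_type C. ring. }
rewrite (is_CInt_unique _ _ _ _ E2).
change plus with Cplus. ring.
Qed.

(* Subtracting from [f] its affine approximation at a point of the cell does not change the
   boundary integral, because the form [dw / (w - z0)] pulls back to a separated form and [dw]
   is exact. *)
Lemma cone_boundary_small f z0 r tau t th eps : entire f -> Cmod z0 < r ->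
  0 < tau -> tau <= t <= 1 -> 0 < eps ->
  exists del, 0 < del /\ forall x1 x2 y1 y2,
    tau <= x1 <= t -> t <= x2 <= 1 -> y1 <= th <= y2 -> x2 - x1 < del -> y2 - y1 < del ->
    Cmod (cone_boundary f z0 r x1 x2 y1 y2) <= eps * ((x2 - x1) + (y2 - y1)) ^ 2.
Proof.
intros Hf Hr Htau Ht Heps. pose proof (Cmod_ge_0 z0) as Hz0.
set (w := cone z0 r t th).
destruct (ex_derive_C_eps f w (Hf w)) as [d Hd].
set (L := 2 * r + Cmod z0). assert (HL : 0 < L) by (unfold L; lra).
set (K := r / (r - Cmod z0)). assert (HK : 0 < K) by (apply Rdiv_lt_0_compat; lra).
assert (Hit : 0 < / tau) by now apply Rinv_0_lt_compat.
(* The final estimate is 2 eta L (1 / tau + K) s^2, where [L] is the Lipschitz constant of the cone,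
   1 / tau bounds the radial coefficient and [K] the angular one; this [eta] turns it into eps
   s^2. *)
set (eta := eps / (2 * L * (/ tau + K))).
assert (Hden : 0 < 2 * L * (/ tau + K)) by (apply Rmult_lt_0_compat; lra).
assert (Heta : 0 < eta) by (apply Rdiv_lt_0_compat; lra).
destruct (Hd eta Heta) as (d0 & Hd0 & Happ).
exists (d0 / (2 * L)). split; [apply Rdiv_lt_0_compat; lra|].
intros x1 x2 y1 y2 Hx1 Hx2 Hy Hdx Hdy.
set (s := (x2 - x1) + (y2 - y1)).
assert (Hs : L * s < d0).
{ replace d0 with (L * (d0 / (2 * L) + d0 / (2 * L))) by (field; lra).
  apply Rmult_lt_compat_l; [easy|]. unfold s; lra. }
set (e := fun w' => (f w' - f w - (w' - w) * d)%C).
assert (He : forall x y, x1 <= x <= x2 -> y1 <= y <= y2 -> Cmod (e (cone z0 r x y)) <= eta * (L * s)).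
{ intros x y Hx' Hy'.
  assert (Hc : Cmod (cone z0 r x y - w) <= L * s).
  { eapply Rle_trans; [apply cone_lipschitz; lra|]. apply Rmult_le_compat_l; [lra|].
    apply Rplus_le_compat; apply Rabs_le; lra. }
  eapply Rle_trans; [apply Happ; lra|]. apply Rmult_le_compat_l; lra. }
(* The linear part of [f] at [w] contributes a constant to the side integrand and a multiple of
   [circ r] to the arc integrand; its constant part drops out of both differences. Subtracting these
   contributions leaves only the error [e]. *)
pose proof (is_CInt_minus _ _ _ _ _ _
  (is_CInt_cone_side f z0 r y1 y2 x1 x2 Hf ltac:(lra) ltac:(lra))
  (is_CInt_const (d * (circ r y1 - circ r y2)) x1 x2)) as E1.
pose proof (is_CInt_minus _ _ _ _ _ _
  (is_CInt_cone_arc f z0 r x1 x2 y1 y2 Hf Hr)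
  (is_CInt_mult_l (d * RtoC (x2 - x1)) _ _ _ _ (is_CInt_circ r y1 y2))) as E2.
apply is_CInt_bound with (M := / tau * (2 * (eta * (L * s)))) in E1.
2: lra.
2: { intros x Hx.
  assert (Hx0 : RtoC x <> 0%C) by (intro E; apply RtoC_inj in E; lra).
  replace (cone_side f z0 r y1 y2 x - d * (circ r y1 - circ r y2))%C with
    (RtoC (/ x) * (e (cone z0 r x y1) - e (cone z0 r x y2)))%C
    by (unfold cone_side, e, cone; rewrite RtoC_inv by lra; field; exact Hx0).
  rewrite Cmod_mult, Cmod_R, Rabs_pos_eq by (left; apply Rinv_0_lt_compat; lra).
  apply Rmult_le_compat; [left; apply Rinv_0_lt_compat; lra|apply Cmod_ge_0|apply Rinv_le_contravar; lra|].
  eapply Rle_trans; [apply Cmod_triangle|]. rewrite Cmod_opp.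
  pose proof (He x y1 ltac:(lra) ltac:(lra)). pose proof (He x y2 ltac:(lra) ltac:(lra)). lra. }
apply is_CInt_bound with (M := K * (2 * (eta * (L * s)))) in E2.
2: lra.
2: { intros y Hy'.
  pose proof (circ_sub_neq0 z0 r y Hr) as Hn.
  replace (cone_arc f z0 r x1 x2 y - d * RtoC (x2 - x1) * circ r y)%C with
    (cauchy_weight z0 r y * (e (cone z0 r x2 y) - e (cone z0 r x1 y)))%C
    by (unfold cone_arc, e, cone, cauchy_weight; rewrite RtoC_minus; field; exact Hn).
  rewrite Cmod_mult. apply Rmult_le_compat; [apply Cmod_ge_0|apply Cmod_ge_0|now apply cauchy_weight_bound|].
  eapply Rle_trans; [apply Cmod_triangle|]. rewrite Cmod_opp.
  pose proof (He x1 y ltac:(lra) ltac:(lra)). pose proof (He x2 y ltac:(lra) ltac:(lra)). lra. }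
unfold cone_boundary.
set (A := CInt (cone_side f z0 r y1 y2) x1 x2) in *.
set (B := CInt (cone_arc f z0 r x1 x2) y1 y2) in *.
assert (Ci2 : (Ci * Ci = -1)%C).
{ unfold Ci, Cmult, RtoC, Copp; simpl. f_equal; ring. }
(* The two subtracted integrals cancel since [Ci * Ci] is -1; this is the exactness of dw. *)
replace (A + Ci * B)%C with
  ((A - RtoC (x2 - x1) * (d * (circ r y1 - circ r y2))) +
   Ci * (B - d * RtoC (x2 - x1) * (- Ci * (circ r y2 - circ r y1))))%C.
2: { transitivity (A + Ci * B - RtoC (x2 - x1) * d * (circ r y1 - circ r y2) * (1 + Ci * Ci))%C; [ring|].
     rewrite Ci2. ring. }
eapply Rle_trans; [apply Cmod_triangle|]. rewrite Cmod_mult, Cmod_Ci, Rmult_1_l.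
eapply Rle_trans; [apply Rplus_le_compat; [exact E1|exact E2]|].
replace eps with (eta * (2 * L * (/ tau + K))) by (unfold eta; set (D := 2 * L * (/ tau + K)) in *; field; lra).
assert (H1 : 0 <= x2 - x1 <= s) by (unfold s; lra).
assert (H2 : 0 <= y2 - y1 <= s) by (unfold s; lra).
assert (Hss : 0 <= 2 * (eta * (L * s))).
{ apply Rmult_le_pos; [lra|]. apply Rmult_le_pos; [lra|]. apply Rmult_le_pos; lra. }
replace (eta * (2 * L * (/ tau + K)) * s ^ 2) with
  (s * (/ tau * (2 * (eta * (L * s)))) + s * (K * (2 * (eta * (L * s))))) by ring.
apply Rplus_le_compat; apply Rmult_le_compat_r; try lra; apply Rmult_le_pos; lra.
Qed.

Lemma cone_boundary_zero f z0 r tau a b : entire f -> Cmod z0 < r -> 0 < tau <= 1 -> a <= b ->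
  cone_boundary f z0 r tau 1 a b = 0%C.
Proof.
intros Hf Hr Htau Hab.
apply (additive_rectangle_zero (cone_boundary f z0 r)); try lra.
- intros. apply cone_boundary_add_t; try easy; lra.
- intros. apply cone_boundary_add_th; try easy; lra.
- intros x y eps Hx Hy Heps.
  destruct (cone_boundary_small f z0 r tau x y eps Hf Hr ltac:(lra) Hx Heps) as (del & Hdel & H).
  exists del. split; [easy|]. intros. apply H; lra.
Qed.

(** The radial sides at angles 0 and 2 PI coincide, so their difference vanishes and the zero
    boundary integral reduces to the arcs: shrinking the circle by [tau] does not change the
    integral. *)
Lemma cone_arc_independent f z0 r tau : entire f -> Cmod z0 < r -> 0 < tau <= 1 ->
  CInt (cone_arc f z0 r tau 1) 0 (2 * PI) = RtoC 0.
Proof.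
intros Hf Hr Htau. pose proof PI_RGT_0 as Hpi.
pose proof (cone_boundary_zero f z0 r tau 0 (2 * PI) Hf Hr Htau ltac:(lra)) as H.
unfold cone_boundary in H.
assert (E : CInt (cone_side f z0 r 0 (2 * PI)) tau 1 = RtoC 0).
{ apply is_CInt_unique. replace (RtoC 0) with (RtoC (1 - tau) * 0)%C by ring.
  apply (is_RInt_ext (V := C_R_NormedModule) (fun _ => RtoC 0)); [|apply is_CInt_const].
  intros t _. unfold cone_side, cone, circ. rewrite cos_2PI, sin_2PI, cos_0, sin_0.
  at_type C. ring. }
rewrite E in H.
rewrite Cplus_0_l in H.
apply Cmod_eq_0. apply (f_equal Cmod) in H. rewrite Cmod_mult, Cmod_Ci, Cmod_0, Rmult_1_l in H. exact H.
Qed.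

(** As the circle shrinks to [z0], continuity replaces [f] by [f z0] under the integral. The
    integral of the weight stays unevaluated here; its value 2 PI comes later from the geometric
    expansion applied to the constant 1. *)
Lemma cauchy_formula f z0 r : entire f -> Cmod z0 < r ->
  (f z0 * CInt (cauchy_weight z0 r) 0 (2 * PI))%C =
  CInt (fun th => f (circ r th) * cauchy_weight z0 r th)%C 0 (2 * PI).
Proof.
intros Hf Hr. pose proof (Cmod_ge_0 z0) as Hz0. pose proof PI_RGT_0 as Hpi.
assert (E0 : is_CInt (fun th => f (circ r th) * cauchy_weight z0 r th)%C 0 (2 * PI)
  (CInt (fun th => f (circ r th) * cauchy_weight z0 r th)%C 0 (2 * PI))).
{ apply CInt_correct. intros th _. apply Ccontinuous_mult.
  - apply Ccontinuous_entire_comp; [easy|apply Ccontinuous_circ].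
  - now apply Ccontinuous_cauchy_weight. }
assert (E1 : is_CInt (cauchy_weight z0 r) 0 (2 * PI) (CInt (cauchy_weight z0 r) 0 (2 * PI))).
{ apply CInt_correct. intros th _. now apply Ccontinuous_cauchy_weight. }
set (A := CInt (fun th => f (circ r th) * cauchy_weight z0 r th)%C 0 (2 * PI)) in *.
set (B := CInt (cauchy_weight z0 r) 0 (2 * PI)) in *.
apply (is_CInt_mult_l (f z0)) in E1.
set (K := r / (r - Cmod z0)). assert (HK : 0 < K) by (apply Rdiv_lt_0_compat; lra).
assert (HD : (A - f z0 * B = 0)%C).
{ apply Cmod_eq_0. apply Rle_antisym; [|apply Cmod_ge_0]. apply le_epsilon. intros eps Heps.
  rewrite Rplus_0_l.
  set (eps' := eps / (2 * PI * K)).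
  assert (Heps' : 0 < eps') by (apply Rdiv_lt_0_compat; [easy|apply Rmult_lt_0_compat; lra]).
  destruct (entire_eps_delta f Hf z0 eps' Heps') as (del & Hdel & H).
  (* The shrunken circle stays within [del] of [z0], because its points are at distance at most tau
     (r + |z0|). *)
  set (tau := Rmin 1 (del / (2 * (r + Cmod z0)))).
  assert (Htau : 0 < tau) by (apply Rmin_glb_lt; [lra|apply Rdiv_lt_0_compat; lra]).
  assert (Htau1 : tau <= 1) by apply Rmin_l.
  assert (Htau2 : tau * (r + Cmod z0) < del).
  { apply Rle_lt_trans with (del / (2 * (r + Cmod z0)) * (r + Cmod z0)).
    - apply Rmult_le_compat_r; [lra|apply Rmin_r].
    - replace (del / (2 * (r + Cmod z0)) * (r + Cmod z0)) with (del / 2) by (field; lra). lra. }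
  pose proof (is_CInt_cone_arc f z0 r tau 1 0 (2 * PI) Hf Hr) as E2.
  rewrite cone_arc_independent in E2 by (try easy; lra).
  pose proof (is_CInt_minus _ _ _ _ _ _ (is_CInt_minus _ _ _ _ _ _ E0 E1) E2) as E3.
  replace (A - f z0 * B)%C with (A - f z0 * B - 0)%C by ring.
  replace eps with ((2 * PI - 0) * (eps' * K)) by (unfold eps'; field; lra).
  eapply is_CInt_bound; [lra| |exact E3].
  intros th _. cbv beta.
  replace (f (circ r th) * cauchy_weight z0 r th - f z0 * cauchy_weight z0 r th - cone_arc f z0 r tau 1 th)%C
    with ((f (cone z0 r tau th) - f z0) * cauchy_weight z0 r th)%C.
  2: { unfold cone_arc. replace (cone z0 r 1 th) with (circ r th) by (unfold cone; ring). ring. }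
  rewrite Cmod_mult. apply Rmult_le_compat; [apply Cmod_ge_0|apply Cmod_ge_0| |now apply cauchy_weight_bound].
  left. apply H. replace (cone z0 r tau th - z0)%C with (RtoC tau * (circ r th - z0))%C by (unfold cone; ring).
  rewrite Cmod_mult, Cmod_R, Rabs_pos_eq by lra.
  eapply Rle_lt_trans; [|exact Htau2]. apply Rmult_le_compat_l; [lra|].
  eapply Rle_trans; [apply Cmod_triangle|]. rewrite Cmod_opp, Cmod_circ; lra. }
replace A with (A - f z0 * B + f z0 * B)%C by ring. rewrite HD. ring.
Qed.

(** * Taylor expansion of entire functions *)

Lemma circ_mult (a b x y : R) : (circ a x * circ b y)%C = circ (a * b) (x + y).
Proof.
unfold circ, Cmult; simpl. rewrite cos_plus, sin_plus. f_equal; ring.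
Qed.

Lemma circ_neq0 (r th : R) : 0 < r -> circ r th <> RtoC 0.
Proof.
intros Hr E. apply (f_equal Cmod) in E. rewrite Cmod_circ, Cmod_0 in E; lra.
Qed.

Lemma circ_inv_pow (r th : R) (n : nat) : 0 < r ->
  ((/ circ r th) ^ n)%C = circ (/ r ^ n) (- (INR n * th)).
Proof.
intros Hr.
assert (E : (/ circ r th)%C = circ (/ r) (- th)).
{ pose proof (circ_neq0 r th Hr) as H0.
  assert (E1 : (circ r th * circ (/ r) (- th) = 1)%C).
  { rewrite circ_mult, Rinv_r by lra. rewrite Rplus_opp_r. unfold circ. rewrite cos_0, sin_0.
    unfold RtoC. f_equal; ring. }
  transitivity (/ circ r th * (circ r th * circ (/ r) (- th)))%C.
  - rewrite E1. ring.
  - field. exact H0. }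
induction n as [|n IH].
- simpl. unfold circ. rewrite Rmult_0_l, Ropp_0, cos_0, sin_0, Rinv_1. unfold RtoC. f_equal; ring.
- rewrite Cpow_S, IH, E, circ_mult, S_INR. f_equal.
  + simpl. field. split; [apply pow_nonzero; lra|lra].
  + ring.
Qed.

Lemma is_CInt_circ_harmonic (r : R) (n : nat) : (0 < n)%nat ->
  is_CInt (fun th => circ r (- (INR n * th))) 0 (2 * PI) (RtoC 0).
Proof.
intros Hn. assert (Hn' : 0 < INR n) by now apply lt_0_INR.
assert (Hc : cos (INR n * (2 * PI)) = 1).
{ replace (INR n * (2 * PI)) with (0 + 2 * INR n * PI) by ring. rewrite cos_period. apply cos_0. }
assert (Hs : sin (INR n * (2 * PI)) = 0).
{ replace (INR n * (2 * PI)) with (0 + 2 * INR n * PI) by ring. rewrite sin_period. apply sin_0. }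
assert (Hcont : forall x, continuous (U := C_UniformSpace) (fun th => circ r (- (INR n * th))) x).
{ intro x. apply (continuous_comp (W := C_UniformSpace) (fun th => - (INR n * th)) (circ r)); [|apply Ccontinuous_circ].
  apply (continuous_opp (K := R_AbsRing) (V := R_NormedModule)).
  apply (continuous_mult (K := R_AbsRing)); [apply continuous_const|apply continuous_id]. }
apply (is_RInt_fct_extend_pair (U := R_NormedModule) (V := R_NormedModule)).
- replace 0 with (minus (r * sin (INR n * (2 * PI)) / INR n) (r * sin (INR n * 0) / INR n)) at 2.
  + apply (is_RInt_derive (V := R_CompleteNormedModule) (fun t => r * sin (INR n * t) / INR n)).
    * intros x _. simpl. rewrite cos_neg. auto_derive; [easy|field; lra].
    * intros x _. exact (Ccontinuous_fst _ _ (Hcont x)).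
  + rewrite Hs, (Rmult_0_r (INR n)), sin_0. unfold minus, plus, opp; simpl. field; lra.
- replace 0 with (minus (r * cos (INR n * (2 * PI)) / INR n) (r * cos (INR n * 0) / INR n)) at 2.
  + apply (is_RInt_derive (V := R_CompleteNormedModule) (fun t => r * cos (INR n * t) / INR n)).
    * intros x _. simpl. rewrite sin_neg. auto_derive; [easy|field; lra].
    * intros x _. exact (Ccontinuous_snd _ _ (Hcont x)).
  + rewrite Hc, Rmult_0_r, cos_0. unfold minus, plus, opp; simpl. field; lra.
Qed.

Lemma Ccontinuous_circ_inv_pow (r th : R) (n : nat) : 0 < r ->
  continuous (U := C_UniformSpace) (fun th => (/ circ r th) ^ n)%C th.
Proof.
intros Hr. induction n as [|n IH].
- apply continuous_const.
- apply Ccontinuous_mult; [|exact IH].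
  apply (Ccontinuous_inv (circ r)); [apply Ccontinuous_circ|now apply circ_neq0].
Qed.

(** With q = z0 / circ r th the weight is 1 / (1 - q), so the partial geometric sum is (1 - q^(N+1))
    times the weight and the error is the integral of h q^(N+1) times the weight. A general [h]
    serves twice: the constant 1 evaluates the weight, and [f] on the circle produces the Taylor
    series. *)
Lemma cauchy_weight_expansion (h : R -> C) (z0 : C) (r M : R) (N : nat) : Cmod z0 < r ->
  (forall th, continuous (U := C_UniformSpace) h th) ->
  (forall th, 0 <= th <= 2 * PI -> Cmod (h th) <= M) ->
  Cmod (CInt (fun th => h th * cauchy_weight z0 r th)%C 0 (2 * PI) -
    sum_n (G := C_AbelianMonoid)
      (fun n => z0 ^ n * CInt (fun th => h th * (/ circ r th) ^ n) 0 (2 * PI))%C N)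
  <= 2 * PI * (M * (r / (r - Cmod z0))) * (Cmod z0 / r) ^ S N.
Proof.
intros Hr Hh HM. pose proof (Cmod_ge_0 z0) as Hz0. pose proof PI_RGT_0 as Hpi.
set (q := fun th => (z0 / circ r th)%C).
assert (E : is_CInt (fun th => h th * (1 - q th ^ S N) * cauchy_weight z0 r th)%C 0 (2 * PI)
  (sum_n (G := C_AbelianMonoid)
      (fun n => z0 ^ n * CInt (fun th => h th * (/ circ r th) ^ n) 0 (2 * PI))%C N)).
{ assert (Ht : forall n, is_CInt (fun th => z0 ^ n * (h th * (/ circ r th) ^ n))%C 0 (2 * PI)
     (z0 ^ n * CInt (fun th => h th * (/ circ r th) ^ n)%C 0 (2 * PI))%C).
  { intro n. apply is_CInt_mult_l, CInt_correct. intros th _.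
    apply Ccontinuous_mult; [apply Hh|apply Ccontinuous_circ_inv_pow; lra]. }
  induction N as [|N IH].
  - rewrite sum_O. apply (is_RInt_ext (V := C_R_NormedModule) (fun th => z0 ^ 0 * (h th * (/ circ r th) ^ 0))%C); [|apply Ht].
    intros th _. at_type C.
    pose proof (circ_neq0 r th ltac:(lra)). pose proof (circ_sub_neq0 z0 r th Hr).
    unfold q, cauchy_weight. simpl. field. now split.
  - rewrite sum_Sn. pose proof (is_CInt_plus _ _ _ _ _ _ IH (Ht (S N))) as HS.
    refine (is_RInt_ext (V := C_R_NormedModule) _ _ _ _ _ _ HS).
    intros th _. at_type C.
    pose proof (circ_neq0 r th ltac:(lra)). pose proof (circ_sub_neq0 z0 r th Hr).
    replace (z0 ^ S N * (h th * (/ circ r th) ^ S N))%C with (h th * q th ^ S N)%C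
      by (unfold q, Cdiv; rewrite Cpow_mult_l; ring).
    rewrite !(Cpow_S (q th) (S N)). unfold cauchy_weight. set (Q := (q th ^ S N)%C). unfold q. field. now split. }
assert (E0 : is_CInt (fun th => h th * cauchy_weight z0 r th)%C 0 (2 * PI)
   (CInt (fun th => h th * cauchy_weight z0 r th)%C 0 (2 * PI))).
{ apply CInt_correct. intros th _. apply Ccontinuous_mult; [apply Hh|now apply Ccontinuous_cauchy_weight]. }
replace (2 * PI * (M * (r / (r - Cmod z0))) * (Cmod z0 / r) ^ S N) with
  ((2 * PI - 0) * (M * (Cmod z0 / r) ^ S N * (r / (r - Cmod z0)))) by ring.
eapply is_CInt_bound; [lra| |exact (is_CInt_minus _ _ _ _ _ _ E0 E)].
intros th Hth. cbv beta.
replace (h th * cauchy_weight z0 r th - h th * (1 - q th ^ S N) * cauchy_weight z0 r th)%C with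
  (h th * q th ^ S N * cauchy_weight z0 r th)%C by ring.
rewrite !Cmod_mult, Cmod_pow. unfold q. rewrite Cmod_div, Cmod_circ by (try apply circ_neq0; lra).
assert (0 <= (Cmod z0 / r) ^ S N) by (apply pow_le, Rle_div_r; lra).
apply Rmult_le_compat; [|apply Cmod_ge_0| |now apply cauchy_weight_bound].
- apply Rmult_le_pos; [apply Cmod_ge_0|easy].
- apply Rmult_le_compat_r; [easy|now apply HM].
Qed.

Lemma geometric_bound_zero (K q x : R) : 0 <= K -> 0 <= q < 1 -> 0 <= x ->
  (forall N, x <= K * q ^ S N) -> x = 0.
Proof.
intros HK Hq Hx H. apply Rle_antisym; [|easy].
apply (is_lim_seq_le (fun _ => x) (fun N => K * q ^ S N) x 0 H (is_lim_seq_const x)).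
replace (Finite 0) with (Rbar_mult K 0) by (simpl; f_equal; ring).
apply is_lim_seq_scal_l. apply -> (is_lim_seq_incr_1 (fun n => q ^ n)).
apply is_lim_seq_geom. rewrite Rabs_pos_eq; lra.
Qed.

(** In the expansion with [h] = 1 every term beyond n = 0 is a nonzero harmonic, whose integral over
    a period is 0. *)
Lemma CInt_cauchy_weight (z0 : C) (r : R) : Cmod z0 < r ->
  CInt (cauchy_weight z0 r) 0 (2 * PI) = RtoC (2 * PI).
Proof.
intros Hr. pose proof (Cmod_ge_0 z0) as Hz0. pose proof PI_RGT_0 as Hpi.
assert (E : (CInt (cauchy_weight z0 r) 0 (2 * PI) - RtoC (2 * PI) = 0)%C).
{ apply Cmod_eq_0.
  apply (geometric_bound_zero (2 * PI * (1 * (r / (r - Cmod z0)))) (Cmod z0 / r)).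
  - apply Rmult_le_pos; [lra|]. rewrite Rmult_1_l. left; apply Rdiv_lt_0_compat; lra.
  - split; [apply Rle_div_r; lra|]. apply Rlt_div_l; lra.
  - apply Cmod_ge_0.
  - intros N.
    pose proof (cauchy_weight_expansion (fun _ => RtoC 1) z0 r 1 N Hr) as H.
    assert (E1 : CInt (fun th => RtoC 1 * cauchy_weight z0 r th)%C 0 (2 * PI) = CInt (cauchy_weight z0 r) 0 (2 * PI)).
    { apply (RInt_ext (V := C_R_CompleteNormedModule)). intros th _. apply Cmult_1_l. }
    assert (E2 : forall n, sum_n (G := C_AbelianMonoid)
      (fun n => z0 ^ n * CInt (fun th => RtoC 1 * (/ circ r th) ^ n) 0 (2 * PI))%C n = RtoC (2 * PI)).
    { induction n as [|n IH].
      - rewrite sum_O.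
        rewrite (is_CInt_unique (fun th => RtoC 1 * (/ circ r th) ^ 0)%C 0 (2 * PI) (RtoC (2 * PI - 0) * (1 * 1))).
        + simpl. rewrite Rminus_0_r. ring.
        + apply is_CInt_const.
      - rewrite sum_Sn, IH.
        rewrite (is_CInt_unique (fun th => RtoC 1 * (/ circ r th) ^ S n)%C 0 (2 * PI) (RtoC 0)).
        + change plus with Cplus. at_type C. ring.
        + refine (is_RInt_ext (V := C_R_NormedModule) _ _ _ _ _ _ (is_CInt_circ_harmonic (/ r ^ S n) (S n) ltac:(lia))).
          intros th _. rewrite circ_inv_pow by lra. symmetry; apply Cmult_1_l. }
    cbv beta in H. rewrite E1, E2 in H. apply H.
    + intros. apply continuous_const.
    + intros. rewrite Cmod_1. lra. }
at_type C.
set (X := CInt (cauchy_weight z0 r) 0 (2 * PI) : C) in *.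
replace X with (X - RtoC (2 * PI) + RtoC (2 * PI))%C by ring. rewrite E. ring.
Qed.

Definition taylor_coef (f : C -> C) (r : R) (n : nat) : C :=
  (RtoC (/ (2 * PI)) * CInt (fun th => f (circ r th) * (/ circ r th) ^ n) 0 (2 * PI))%C.

Lemma taylor_expansion (f : C -> C) (r : R) : entire f -> 0 < r ->
  exists M, 0 <= M /\ forall z N, Cmod z < r ->
  Cmod (f z - sum_n (G := C_AbelianMonoid) (fun n => taylor_coef f r n * z ^ n)%C N) <=
  M * (r / (r - Cmod z)) * (Cmod z / r) ^ S N.
Proof.
intros Hf Hr. pose proof PI_RGT_0 as Hpi.
assert (Hc : forall th, continuous (U := C_UniformSpace) (fun th => f (circ r th)) th).
{ intro th. apply Ccontinuous_entire_comp; [easy|apply Ccontinuous_circ]. }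
destruct (continuity_ab_maj (fun th => Cmod (f (circ r th))) 0 (2 * PI)) as (t0 & Ht0 & _); [lra| |].
{ intros th _. apply continuity_pt_filterlim.
  apply (continuous_ext (fun th => norm (V := C_R_NormedModule) (f (circ r th)))).
  { intros. symmetry; apply Cmod_norm. }
  apply (continuous_comp (V := C_UniformSpace) (W := R_UniformSpace) (fun th => f (circ r th)) (norm (V := C_R_NormedModule)) th (Hc th)).
  apply (filterlim_norm (V := C_R_NormedModule)). }
set (M := Cmod (f (circ r t0))) in *.
exists M. split; [apply Cmod_ge_0|].
intros z N Hz.
pose proof (cauchy_weight_expansion (fun th => f (circ r th)) z r M N Hz Hc Ht0) as H.
cbv beta in H. rewrite <- cauchy_formula, CInt_cauchy_weight in H by easy.
assert (E : (f z - sum_n (G := C_AbelianMonoid) (fun n => taylor_coef f r n * z ^ n) N =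
  RtoC (/ (2 * PI)) * (f z * RtoC (2 * PI) - sum_n (G := C_AbelianMonoid)
         (fun n : nat => z ^ n * CInt (fun th => f (circ r th) * (/ circ r th) ^ n) 0 (2 * PI)) N))%C).
{ assert (Es : forall n, sum_n (G := C_AbelianMonoid) (fun n => taylor_coef f r n * z ^ n)%C n =
    (RtoC (/ (2 * PI)) * sum_n (G := C_AbelianMonoid)
         (fun n : nat => z ^ n * CInt (fun th => f (circ r th) * (/ circ r th) ^ n) 0 (2 * PI)) n)%C).
  { induction n as [|n IH].
    - rewrite !sum_O. unfold taylor_coef. at_type C. ring.
    - rewrite !sum_Sn, IH. unfold taylor_coef. change plus with Cplus. at_type C. ring. }
  rewrite Es. rewrite RtoC_inv by lra. field. intro E. apply RtoC_inj in E. lra. }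
rewrite E, Cmod_mult, Cmod_R, Rabs_pos_eq by (left; apply Rinv_0_lt_compat; lra).
apply Rle_trans with (/ (2 * PI) * (2 * PI * (M * (r / (r - Cmod z))) * (Cmod z / r) ^ S N)).
- apply Rmult_le_compat_l; [left; apply Rinv_0_lt_compat; lra|exact H].
- right. field. pose proof (Cmod_ge_0 z). lra.
Qed.

Lemma CV_radius_ge (a : nat -> R) (x : R) :
  ex_series (fun n => a n * x ^ n) -> Rbar_le (Rabs x) (CV_radius a).
Proof.
intros H. apply Rbar_not_lt_le. intro Hlt.
apply (CV_disk_outside a x Hlt). now apply ex_series_lim_0.
Qed.

Lemma power_series_unique (a b : nat -> R) (g : R -> R) (r : R) : 0 < r ->
  (forall x, Rabs x < r -> is_series (fun n => a n * x ^ n) (g x)) ->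
  (forall x, Rabs x < r -> is_series (fun n => b n * x ^ n) (g x)) ->
  forall n, a n = b n.
Proof.
intros Hr Ha Hb n.
assert (Hr2 : Rabs (r / 2) < r) by (rewrite Rabs_pos_eq; lra).
assert (Hpos : Rbar_lt 0 (Rabs (r / 2))) by (simpl; rewrite Rabs_pos_eq; lra).
apply PSeries_ext_recip.
- eapply Rbar_lt_le_trans; [exact Hpos|]. apply CV_radius_ge. eexists; now apply Ha.
- eapply Rbar_lt_le_trans; [exact Hpos|]. apply CV_radius_ge. eexists; now apply Hb.
- exists (mkposreal r Hr). intros x Hx.
  assert (Hx' : Rabs x < r).
  { unfold ball in Hx; simpl in Hx; unfold AbsRing_ball, minus, plus, opp, abs in Hx; simpl in Hx.
    now rewrite Ropp_0, Rplus_0_r in Hx. }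
  unfold PSeries. rewrite (is_series_unique _ _ (Ha x Hx')), (is_series_unique _ _ (Hb x Hx')). reflexivity.
Qed.

Lemma fst_sum_RtoC (c : nat -> C) (x : R) (N : nat) :
  fst (sum_n (G := C_AbelianMonoid) (fun n => c n * RtoC x ^ n)%C N) = sum_n (fun n => fst (c n) * x ^ n) N.
Proof.
induction N as [|N IH].
- rewrite !sum_O. rewrite <- RtoC_pow. simpl. ring.
- rewrite !sum_Sn, <- IH, <- RtoC_pow. simpl. unfold plus; simpl. ring.
Qed.

Lemma snd_sum_RtoC (c : nat -> C) (x : R) (N : nat) :
  snd (sum_n (G := C_AbelianMonoid) (fun n => c n * RtoC x ^ n)%C N) = sum_n (fun n => snd (c n) * x ^ n) N.
Proof.
induction N as [|N IH].
- rewrite !sum_O. rewrite <- RtoC_pow. simpl. ring.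
- rewrite !sum_Sn, <- IH, <- RtoC_pow. simpl. unfold plus; simpl. ring.
Qed.

Lemma im_le_Cmod (z : C) : Rabs (snd z) <= Cmod z.
Proof.
eapply Rle_trans; [apply (Rmax_r (Rabs (fst z)))|apply Rmax_Cmod].
Qed.

Lemma is_lim_seq_of_dist (u : nat -> R) (l : R) (d : nat -> R) :
  (forall n, Rabs (u n - l) <= d n) -> is_lim_seq d 0 -> is_lim_seq u l.
Proof.
intros H Hd.
apply (is_lim_seq_ext (fun n => (u n - l) + l)); [intro; ring|].
replace (Finite l) with (Rbar_plus 0 l) by (simpl; f_equal; ring).
apply is_lim_seq_plus'; [|apply is_lim_seq_const].
apply is_lim_seq_abs_0.
apply (is_lim_seq_le_le (fun _ => 0) _ d); [|apply is_lim_seq_const|exact Hd].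
intro n. split; [apply Rabs_pos|apply H].
Qed.

Lemma taylor_converges (f : C -> C) (r : R) (z : C) : entire f -> Cmod z < r ->
  is_lim_seq (fun N => Cmod (f z - sum_n (G := C_AbelianMonoid) (fun n => taylor_coef f r n * z ^ n)%C N)) 0.
Proof.
intros Hf Hz. pose proof (Cmod_ge_0 z).
destruct (taylor_expansion f r Hf) as (M & HM & HT); [lra|].
apply (is_lim_seq_le_le (fun _ => 0) _ (fun N => M * (r / (r - Cmod z)) * (Cmod z / r) ^ S N)).
- intro N. split; [apply Cmod_ge_0|now apply HT].
- apply is_lim_seq_const.
- replace (Finite 0) with (Rbar_mult (M * (r / (r - Cmod z))) 0) by (simpl; f_equal; ring).
  apply is_lim_seq_scal_l. apply -> (is_lim_seq_incr_1 (fun n => (Cmod z / r) ^ n)).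
  apply is_lim_seq_geom. rewrite Rabs_pos_eq; [apply Rlt_div_l; lra|apply Rle_div_r; lra].
Qed.

(** [taylor_coef] could depend on the radius. On the real axis the real parts of the coefficients
    sum to [rho] and the imaginary parts to 0, so by uniqueness of real power series the former
    agree for all radii and the latter vanish. The coefficients at radius 1 therefore serve every
    [z]. *)
Lemma entire_real_power_series (f : C -> C) (rho : R -> R) : entire f ->
  (forall x : R, f (RtoC x) = RtoC (rho x)) ->
  exists a : nat -> R, forall z : C,
    is_lim_seq (fun N => Cmod (f z - sum_n (G := C_AbelianMonoid) (fun n => RtoC (a n) * z ^ n)%C N)) 0.
Proof.
intros Hf Hx.
assert (Hre : forall r x, Rabs x < r -> is_series (fun n => fst (taylor_coef f r n) * x ^ n) (rho x)).
{ intros r x Hr. rewrite <- Cmod_R in Hr.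
  apply (is_lim_seq_of_dist _ _ _) with (2 := taylor_converges f r (RtoC x) Hf Hr).
  intro N. rewrite <- fst_sum_RtoC, Hx, Rabs_minus_sym.
  exact (Rle_trans _ _ _ (Rle_refl _) (re_le_Cmod (RtoC (rho x) - _))). }
assert (Him : forall r x, Rabs x < r -> is_series (fun n => snd (taylor_coef f r n) * x ^ n) 0).
{ intros r x Hr. rewrite <- Cmod_R in Hr.
  apply (is_lim_seq_of_dist _ _ _) with (2 := taylor_converges f r (RtoC x) Hf Hr).
  intro N. rewrite <- snd_sum_RtoC, Hx, Rabs_minus_sym.
  exact (Rle_trans _ _ _ (Rle_refl _) (im_le_Cmod (RtoC (rho x) - _))). }
exists (fun n => fst (taylor_coef f 1 n)). intros z.
set (r := Cmod z + 1). pose proof (Cmod_ge_0 z).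
assert (E : forall n, RtoC (fst (taylor_coef f 1 n)) = taylor_coef f r n).
{ intro n. rewrite (surjective_pairing (taylor_coef f r n)). unfold RtoC. f_equal.
  - apply (power_series_unique (fun n => fst (taylor_coef f 1 n)) (fun n => fst (taylor_coef f r n)) rho 1); [lra|intros; now apply Hre|].
    intros; apply Hre. unfold r; lra.
  - apply (power_series_unique (fun _ => 0) (fun n => snd (taylor_coef f r n)) (fun _ => 0) 1); [lra| |].
    + intros x _. apply (is_series_ext (fun _ => 0)); [intro; symmetry; apply Rmult_0_l|].
      apply (filterlim_ext (fun _ => 0)); [|apply filterlim_const].
      intro m. rewrite sum_n_const. symmetry; apply Rmult_0_r.
    + intros; apply Him. unfold r; lra. }
apply (is_lim_seq_ext (fun N => Cmod (f z - sum_n (G := C_AbelianMonoid) (fun n => taylor_coef f r n * z ^ n)%C N))).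
- intro N. apply (f_equal (fun s => Cmod (f z - s))). apply sum_n_ext. intro n. now rewrite E.
- apply taylor_converges; [easy|unfold r; lra].
Qed.

(** * Termwise integration of power series *)

Definition power_series (a : nat -> R) (g : R -> R) : Prop :=
  forall x, is_series (fun n => a n * x ^ n) (g x).

Lemma power_series_radius a g (x : R) : power_series a g -> Rbar_lt (Rabs x) (CV_radius a).
Proof.
intros H. apply Rbar_lt_le_trans with (Rabs (Rabs x + 1)).
- simpl. pose proof (Rabs_pos x). rewrite (Rabs_pos_eq (Rabs x + 1)); lra.
- apply CV_radius_ge. eexists; apply H.
Qed.

Lemma power_series_abs a g (x : R) : power_series a g -> 0 <= x ->
  ex_series (fun n => Rabs (a n) * x ^ n).
Proof.
intros H Hx.
apply (ex_series_ext (fun n => Rabs (a n * x ^ n))).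
- intro n. rewrite Rabs_mult, (Rabs_pos_eq (x ^ n)); [easy|now apply pow_le].
- apply CV_disk_inside. now apply power_series_radius with g.
Qed.

Lemma power_series_continuous a g (x : R) : power_series a g -> continuous g x.
Proof.
intros H. apply (continuous_ext (PSeries a)).
- intro y. apply is_series_unique, H.
- apply continuity_pt_filterlim, PSeries_continuity. now apply power_series_radius with g.
Qed.

Lemma series_tail_bound (u v : nat -> R) (U V : R) (N : nat) :
  (forall n, Rabs (u n) <= v n) -> is_series u U -> is_series v V ->
  Rabs (U - sum_n u N) <= V - sum_n v N.
Proof.
intros Huv HU HV.
assert (Hk : forall k, Rabs (sum_n u (N + k) - sum_n u N) <= sum_n v (N + k) - sum_n v N).
{ induction k as [|k IH].
  - rewrite Nat.add_0_r, Rminus_diag, Rminus_diag, Rabs_R0. lra.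
  - rewrite Nat.add_succ_r, !sum_Sn. unfold plus; simpl.
    replace (sum_n u (N + k) + u (S (N + k)) - sum_n u N) with (sum_n u (N + k) - sum_n u N + u (S (N + k))) by ring.
    eapply Rle_trans; [apply Rabs_triang|]. specialize (Huv (S (N + k))). lra. }
assert (Hshift : forall (w : nat -> R) W, is_series w W -> is_lim_seq (fun k => sum_n w (N + k)) W).
{ intros w W HW. apply (is_lim_seq_ext (fun k => sum_n w (k + N))).
  - intro k. now rewrite Nat.add_comm.
  - apply -> (is_lim_seq_incr_n (sum_n w) N). exact HW. }
apply (is_lim_seq_le (fun k => Rabs (sum_n u (N + k) - sum_n u N)) (fun k => sum_n v (N + k) - sum_n v N)
  (Rabs (U - sum_n u N)) (V - sum_n v N) Hk).
- apply (is_lim_seq_abs _ (U - sum_n u N)).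
  apply is_lim_seq_minus'; [now apply Hshift|apply is_lim_seq_const].
- apply is_lim_seq_minus'; [now apply Hshift|apply is_lim_seq_const].
Qed.

Lemma RInt_sum_n (f : nat -> R -> R) (b c : R) (N : nat) :
  (forall n, ex_RInt (f n) b c) ->
  is_RInt (fun x => sum_n (fun n => f n x) N) b c (sum_n (fun n => RInt (f n) b c) N).
Proof.
intros H. induction N as [|N IH].
- rewrite sum_O. apply (is_RInt_ext (f 0%nat)).
  + intros; now rewrite sum_O.
  + now apply (RInt_correct (V := R_CompleteNormedModule)).
- rewrite sum_Sn. apply (is_RInt_ext (fun x => plus (sum_n (fun n => f n x) N) (f (S N) x))).
  + intros; now rewrite sum_Sn.
  + apply (is_RInt_plus (V := R_NormedModule)); [exact IH|].
    now apply (RInt_correct (V := R_CompleteNormedModule)).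
Qed.

Lemma continuous_pow_R (n : nat) (x : R) : continuous (fun y => y ^ n) x.
Proof.
apply (ex_derive_continuous (V := R_NormedModule) (fun y => y ^ n)). auto_derive. easy.
Qed.

(** Weierstrass test: on [b, c] the tail of the series is at most the tail of the series of |a_n|
    c^n, and [w] is bounded there. *)
Lemma RInt_power_series a g (w : R -> R) (b c : R) : power_series a g -> 0 <= b <= c ->
  (forall x, b <= x <= c -> continuous w x) ->
  is_series (fun n => a n * RInt (fun x => x ^ n * w x) b c) (RInt (fun x => g x * w x) b c).
Proof.
intros Hg Hbc Hw.
assert (Hmm : forall z, Rmin b c <= z <= Rmax b c -> b <= z <= c)
  by (rewrite Rmin_left, Rmax_right by lra; easy).
destruct (continuity_ab_maj (fun x => Rabs (w x)) b c) as (x0 & Hx0 & _); [lra| |].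
{ intros x Hx. apply continuity_pt_filterlim. apply (continuous_Rabs_comp w). now apply Hw. }
set (W := Rabs (w x0)) in *.
assert (HW : 0 <= W) by apply Rabs_pos.
destruct (power_series_abs a g c Hg ltac:(lra)) as [V HV].
assert (Hn : forall n, ex_RInt (fun x => x ^ n * w x) b c).
{ intro n. apply (ex_RInt_continuous (V := R_CompleteNormedModule)). intros z Hz.
  apply (continuous_mult (K := R_AbsRing)); [apply continuous_pow_R|auto]. }
assert (Hgw : is_RInt (fun x => g x * w x) b c (RInt (fun x => g x * w x) b c)).
{ apply (RInt_correct (V := R_CompleteNormedModule)).
  apply (ex_RInt_continuous (V := R_CompleteNormedModule)). intros z Hz.
  apply (continuous_mult (K := R_AbsRing)); [eapply power_series_continuous; exact Hg|auto]. }
apply (is_lim_seq_of_dist _ _ (fun N => (c - b) * (W * (V - sum_n (fun n => Rabs (a n) * c ^ n) N)))).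
- intro N.
  pose proof (RInt_sum_n (fun n x => a n * (x ^ n * w x)) b c N
    (fun n => ex_RInt_scal (V := R_NormedModule) _ _ _ (a n) (Hn n))) as HS.
  rewrite (sum_n_ext _ (fun n => RInt (fun x => a n * (x ^ n * w x)) b c)).
  2: { intro n. symmetry. apply (RInt_scal (V := R_CompleteNormedModule)). apply Hn. }
  rewrite Rabs_minus_sym.
  refine (norm_RInt_le_const (V := R_NormedModule) _ b c _ _ ltac:(lra) _
    (is_RInt_minus (V := R_NormedModule) _ _ _ _ _ _ Hgw HS)).
  intros x Hx.
  assert (E : sum_n (fun n => a n * (x ^ n * w x)) N = sum_n (fun n => a n * x ^ n) N * w x).
  { rewrite <- (sum_n_mult_r (K := R_Ring) (w x)). apply sum_n_ext. intro n. unfold mult; simpl. ring. }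
  change (Rabs (g x * w x - sum_n (fun n => a n * (x ^ n * w x)) N) <=
    W * (V - sum_n (fun n => Rabs (a n) * c ^ n) N)).
  rewrite E. replace (g x * w x - sum_n (fun n => a n * x ^ n) N * w x)
    with (w x * (g x - sum_n (fun n => a n * x ^ n) N)) by ring.
  rewrite Rabs_mult. apply Rmult_le_compat; try apply Rabs_pos; [now apply Hx0|].
  apply series_tail_bound; [|apply Hg|exact HV].
  intro n. rewrite Rabs_mult. apply Rmult_le_compat_l; [apply Rabs_pos|].
  rewrite Rabs_pos_eq by (apply pow_le; lra). apply pow_incr. lra.
- replace (Finite 0) with (Rbar_mult (c - b) (Rbar_mult W (V - V))) by (simpl; f_equal; ring).
  apply is_lim_seq_scal_l, is_lim_seq_scal_l, is_lim_seq_minus'; [apply is_lim_seq_const|exact HV].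
Qed.

(** A primitive of x^(n - m), written as a quotient to stay with natural exponents. Its integration
    constant is chosen so that the value at x > 0 is the finite part of the integral from 0 to x. *)
Definition mono_prim (n m : nat) (x : R) : R :=
  if Nat.eq_dec (S n) m then ln x else x ^ S n / x ^ m / (INR (S n) - INR m).

Lemma INR_neq_dist (n m : nat) : n <> m -> 1 <= Rabs (INR n - INR m).
Proof.
intros H. destruct (Nat.lt_ge_cases n m) as [Hl|Hl].
- rewrite Rabs_minus_sym, Rabs_pos_eq.
  + rewrite <- minus_INR by lia. change 1 with (INR 1). apply le_INR. lia.
  + rewrite <- minus_INR by lia. apply pos_INR.
- rewrite Rabs_pos_eq.
  + rewrite <- minus_INR by lia. change 1 with (INR 1). apply le_INR. lia.
  + rewrite <- minus_INR by lia. apply pos_INR.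
Qed.

Lemma is_derive_mono_prim (n m : nat) (x : R) : 0 < x ->
  is_derive (mono_prim n m) x (x ^ n * / x ^ m).
Proof.
intros Hx. unfold mono_prim. destruct (Nat.eq_dec (S n) m) as [<-|Hne].
- auto_derive; [easy|]. simpl. field. split; [apply pow_nonzero|]; lra.
- assert (Hd : INR (S n) - INR m <> 0).
  { intro E. pose proof (INR_neq_dist _ _ Hne) as HH. rewrite E, Rabs_R0 in HH. lra. }
  assert (Hxm : x ^ m <> 0) by (apply pow_nonzero; lra).
  auto_derive; [easy|].
  change (match n with 0%nat => 1 | S _ => INR n + 1 end) with (INR (S n)).
  set (p := INR (S n)) in *.
  destruct m as [|m].
  + change (INR 0) with 0 in *. simpl pow in *. simpl Nat.pred. field.
    intro E; apply Hd; lra.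
  + set (q := INR (S m)) in *. simpl Nat.pred. simpl pow in *.
    field. repeat split; first [lra | exact Hd | apply pow_nonzero; lra].
Qed.

Lemma continuous_inv_pow (m : nat) (x : R) : 0 < x -> continuous (fun y => / y ^ m) x.
Proof.
intros Hx. apply (ex_derive_continuous (V := R_NormedModule) (fun y => / y ^ m)).
auto_derive. apply pow_nonzero; lra.
Qed.

Lemma RInt_mono (n m : nat) (b c : R) : 0 < b <= c ->
  RInt (fun x => x ^ n * / x ^ m) b c = mono_prim n m c - mono_prim n m b.
Proof.
intros H. apply (is_RInt_unique (V := R_CompleteNormedModule)).
apply (is_RInt_derive (V := R_CompleteNormedModule)); rewrite Rmin_left, Rmax_right by lra; intros x Hx.
- apply is_derive_mono_prim. lra.
- apply (continuous_mult (K := R_AbsRing)); [apply continuous_pow_R|apply continuous_inv_pow; lra].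
Qed.

(** The factor beside [x ^ n] does not depend on [n], so the absolute convergence of the series of
    a_n x^n carries over. The denominator is harmless because distinct integers are at distance at
    least 1. *)
Lemma mono_prim_bound (n m : nat) (x : R) : 0 < x ->
  Rabs (mono_prim n m x) <= x ^ n * (x / x ^ m * (1 + Rabs (ln x))).
Proof.
intros Hx. pose proof (Rabs_pos (ln x)).
assert (Hxn : forall k, 0 < x ^ k) by (intro; now apply pow_lt).
unfold mono_prim. destruct (Nat.eq_dec (S n) m) as [<-|Hne].
- replace (x ^ n * (x / x ^ S n * (1 + Rabs (ln x)))) with (1 + Rabs (ln x)).
  + lra.
  + simpl. field. split; [apply Rgt_not_eq, Hxn|lra].
- pose proof (INR_neq_dist _ _ Hne) as Hd.
  unfold Rdiv at 1. rewrite Rabs_mult, Rabs_inv.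
  assert (Hp : 0 < x ^ S n / x ^ m) by (apply Rdiv_lt_0_compat; apply Hxn).
  rewrite Rabs_pos_eq by lra.
  replace (x ^ n * (x / x ^ m * (1 + Rabs (ln x)))) with (x ^ S n / x ^ m * (1 + Rabs (ln x)))
    by (simpl; field; apply Rgt_not_eq, Hxn).
  apply Rmult_le_compat_l; [lra|].
  assert (/ Rabs (INR (S n) - INR m) <= 1) by (rewrite <- Rinv_1; apply Rinv_le_contravar; lra). lra.
Qed.

(** Plays two roles for g(x) = sum_n a_n x^n: a primitive of g(x) / x^m on x > 0, and, for m >= 1,
    the finite part of the integral of that quotient from 0 to x. *)
Definition fp_series (a : nat -> R) (m : nat) (x : R) : R := Series (fun n => a n * mono_prim n m x).

Lemma ex_series_fp_abs a g (m : nat) (x : R) : power_series a g -> 0 < x ->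
  ex_series (fun n => Rabs (a n * mono_prim n m x)).
Proof.
intros Hg Hx.
apply (ex_series_le (V := R_CompleteNormedModule) _ (fun n => Rabs (a n) * x ^ n * (x / x ^ m * (1 + Rabs (ln x))))).
- intro n. change (Rabs (Rabs (a n * mono_prim n m x)) <= Rabs (a n) * x ^ n * (x / x ^ m * (1 + Rabs (ln x)))).
  rewrite Rabs_Rabsolu, Rabs_mult, Rmult_assoc. apply Rmult_le_compat_l; [apply Rabs_pos|].
  now apply mono_prim_bound.
- apply ex_series_scal_r. apply power_series_abs with g; [easy|lra].
Qed.

Lemma is_series_fp a g (m : nat) (x : R) : power_series a g -> 0 < x ->
  is_series (fun n => a n * mono_prim n m x) (fp_series a m x).
Proof.
intros Hg Hx. apply Series_correct, ex_series_Rabs. now apply ex_series_fp_abs with g.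
Qed.

Lemma is_RInt_fp a g (m : nat) (b c : R) : power_series a g -> 0 < b <= c ->
  is_RInt (fun x => g x / x ^ m) b c (fp_series a m c - fp_series a m b).
Proof.
intros Hg Hbc.
assert (Hmm : forall z, Rmin b c <= z <= Rmax b c -> b <= z <= c)
  by (rewrite Rmin_left, Rmax_right by lra; easy).
assert (E : RInt (fun x => g x / x ^ m) b c = fp_series a m c - fp_series a m b).
{ pose proof (RInt_power_series a g (fun x => / x ^ m) b c Hg ltac:(lra)
    (fun x Hx => continuous_inv_pow m x ltac:(lra))) as H1.
  pose proof (is_series_minus _ _ _ _ (is_series_fp a g m c Hg ltac:(lra)) (is_series_fp a g m b Hg ltac:(lra))) as H2.
  apply is_series_unique in H1. apply is_series_unique in H2.
  unfold Rdiv. rewrite <- H1. etransitivity; [|exact H2]. apply Series_ext. intro n.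
  rewrite RInt_mono by lra. unfold plus, opp; simpl. ring. }
rewrite <- E. apply (RInt_correct (V := R_CompleteNormedModule)).
apply (ex_RInt_continuous (V := R_CompleteNormedModule)). intros z Hz. apply Hmm in Hz.
apply (continuous_mult (K := R_AbsRing)); [eapply power_series_continuous; exact Hg|apply continuous_inv_pow; lra].
Qed.

(** * Finite parts *)

Lemma sum_n_m_rev (g : nat -> R) (q : nat) :
  sum_n_m (fun j => g (S q - j)%nat) 1 (S q) = sum_n g q.
Proof.
induction q as [|q IH].
- rewrite sum_n_n, sum_O. reflexivity.
- rewrite sum_Sn_m by lia. rewrite sum_Sn, <- IH, <- (sum_n_m_S (fun j => g (S (S q) - j)%nat)).
  replace (S (S q) - 1)%nat with (S q) by lia. apply plus_comm.
Qed.

Lemma at_right_scal (c : R) : 0 < c -> filterlim (fun x => c * x) (at_right 0) (at_right 0).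
Proof.
intros Hc P [e He].
assert (Hd : 0 < e / c) by (apply Rdiv_lt_0_compat; [apply cond_pos|easy]).
exists (mkposreal _ Hd). intros y Hy Hy0.
assert (Hy' : Rabs y < e / c).
{ unfold ball in Hy; simpl in Hy; unfold AbsRing_ball, minus, plus, opp, abs in Hy; simpl in Hy.
  now rewrite Ropp_0, Rplus_0_r in Hy. }
apply He; [|now apply Rmult_lt_0_compat].
unfold ball; simpl; unfold AbsRing_ball, minus, plus, opp, abs; simpl.
rewrite Ropp_0, Rplus_0_r, Rabs_mult, (Rabs_pos_eq c) by lra.
replace (pos e) with (c * (e / c)) by (field; lra). now apply Rmult_lt_compat_l.
Qed.

Lemma at_right_pos : at_right 0 (fun x => 0 < x).
Proof. exists (mkposreal 1 Rlt_0_1). easy. Qed.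

Lemma at_right_lt (a : R) : 0 < a -> at_right 0 (fun x => x < a).
Proof.
intros Ha. exists (mkposreal a Ha). intros y Hy _.
unfold ball in Hy; simpl in Hy; unfold AbsRing_ball, minus, plus, opp, abs in Hy; simpl in Hy.
rewrite Ropp_0, Rplus_0_r in Hy. apply Rabs_def2 in Hy. lra.
Qed.

Lemma filterlim_Rminus {T : Type} (F : (T -> Prop) -> Prop) {FF : Filter F} (u v : T -> R) (U V : R) :
  filterlim u F (locally U) -> filterlim v F (locally V) ->
  filterlim (fun x => u x - v x) F (locally (U - V)).
Proof.
intros Hu Hv.
apply (filterlim_comp_2 (G := locally U) (H := locally (- V)) u (fun x => - v x) Rplus Hu);
  [|apply (filterlim_plus (V := R_NormedModule) U (- V))].
eapply filterlim_comp; [exact Hv|]. apply (filterlim_opp (V := R_NormedModule)).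
Qed.

Lemma divergent_terms_S (n : nat) (d : nat -> R) (l x : R) :
  divergent_terms (S n) d l x = divergent_terms n d l x + d (S n) / x ^ S n.
Proof.
unfold divergent_terms. rewrite sum_n_Sm by lia. unfold plus; simpl. ring.
Qed.

(* For [K = 2 ^ n] this removes the term of order [x ^ (- n)]. *)
Lemma divergent_terms_half (n : nat) (d : nat -> R) (l x : R) (K : R) : 0 < x ->
  K * divergent_terms n d l x - divergent_terms n d l (/ 2 * x) - l * ln 2 =
  divergent_terms n (fun j => (K - 2 ^ j) * d j) ((K - 1) * l) x.
Proof.
intros Hx. induction n as [|n IH].
- unfold divergent_terms. rewrite !sum_n_m_zero by lia. change (zero (G := R_AbelianMonoid)) with 0.
  rewrite ln_mult by lra. rewrite ln_Rinv by lra. ring.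
- rewrite !divergent_terms_S, <- IH, Rpow_mult_distr, pow_inv.
  field. split; apply pow_nonzero; lra.
Qed.

(** Comparing the values at x and x / 2 produces a shorter combination that still converges: a
    suitable factor [K] removes the top inverse power. When only the logarithm is left, K = 1
    removes it as well, and the limit reads 0 = - l ln 2. *)
Lemma divergent_terms_limit (n : nat) : forall (d : nat -> R) (l L : R),
  filterlim (divergent_terms n d l) (at_right 0) (locally L) -> l = 0 /\ L = 0.
Proof.
assert (Hhalf : forall n d l L K, filterlim (divergent_terms n d l) (at_right 0) (locally L) ->
  filterlim (divergent_terms n (fun j => (K - 2 ^ j) * d j) ((K - 1) * l)) (at_right 0)
    (locally ((K - 1) * L - l * ln 2))).
{ intros m d l L K H.
  pose proof (filterlim_comp _ _ _ _ _ _ _ _ (at_right_scal (/ 2) ltac:(lra)) H) as H2.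
  apply (filterlim_ext_loc (fun x => K * divergent_terms m d l x - divergent_terms m d l (/ 2 * x) - l * ln 2)).
  { apply filter_imp with (2 := at_right_pos). intros x Hx. now apply divergent_terms_half. }
  replace ((K - 1) * L - l * ln 2) with (K * L - L - l * ln 2) by ring.
  assert (HK : filterlim (fun x => K * divergent_terms m d l x) (at_right 0) (locally (K * L))).
  { apply (filterlim_comp _ _ _ _ (fun y => K * y) _ _ _ H).
    apply (filterlim_scal_r (V := R_NormedModule)). }
  apply (filterlim_Rminus (at_right 0)); [apply (filterlim_Rminus (at_right 0)); assumption|apply filterlim_const]. }
induction n as [|n IH]; intros d l L H.
- pose proof (Hhalf 0%nat d l L 1 H) as H1.
  assert (Hl : l = 0).
  { assert (E : 0 = (1 - 1) * L - l * ln 2).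
    { apply (filterlim_locally_unique (V := R_NormedModule) (F := at_right 0) (fun _ => 0)); [apply filterlim_const|].
      eapply filterlim_ext; [|exact H1]. intro x. unfold divergent_terms. rewrite sum_n_m_zero by lia.
      change (zero (G := R_AbelianMonoid)) with 0. at_type R. ring. }
    pose proof (ln_lt_2). nra. }
  split; [easy|]. symmetry.
  apply (filterlim_locally_unique (V := R_NormedModule) (F := at_right 0) (fun _ => 0)); [apply filterlim_const|].
  eapply filterlim_ext; [|exact H]. intro x. unfold divergent_terms. rewrite sum_n_m_zero by lia.
  change (zero (G := R_AbelianMonoid)) with 0. rewrite Hl. at_type R. ring.
(* The top coefficient is multiplied by 2^(n+1) - 2^(n+1) = 0, while [l] is multiplied by the
   nonzero 2^(n+1) - 1. *)
- pose proof (Hhalf (S n) d l L (2 ^ S n) H) as H1.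
  destruct (IH (fun j => (2 ^ S n - 2 ^ j) * d j) ((2 ^ S n - 1) * l) ((2 ^ S n - 1) * L - l * ln 2)) as [E1 E2].
  { eapply filterlim_ext; [|exact H1]. intro x. rewrite divergent_terms_S.
    replace ((2 ^ S n - 2 ^ S n) * d (S n) / x ^ S n) with 0 by (unfold Rdiv; ring). ring. }
  assert (Hp : 1 <= 2 ^ n) by (apply pow_R1_Rle; lra).
  simpl in E1, E2.
  assert (Hreg : forall x, (2 * 2 ^ n - 1) * x = 0 -> x = 0).
  { intros x E. apply Rmult_integral in E. destruct E; [lra|easy]. }
  apply Hreg in E1. split; [exact E1|]. apply Hreg. rewrite E1 in E2. lra.
Qed.

(** The two lists may differ in length, so both are padded with zeros up to n1 + n2. *)
Lemma divergent_terms_minus (n1 n2 : nat) (d1 d2 : nat -> R) (l1 l2 : R) :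
  exists n d, forall x, divergent_terms n1 d1 l1 x - divergent_terms n2 d2 l2 x = divergent_terms n d (l1 - l2) x.
Proof.
assert (Hpad : forall n d k x, sum_n_m (fun j => (if Compare_dec.le_dec j n then d j else 0) / x ^ j) 1 (n + k) =
  sum_n_m (fun j => d j / x ^ j) 1 n).
{ intros n d k x. induction k as [|k IH].
  - rewrite Nat.add_0_r. apply sum_n_m_ext_loc. intros j Hj. destruct (Compare_dec.le_dec j n); [easy|lia].
  - rewrite Nat.add_succ_r, sum_n_Sm by lia. rewrite IH. destruct (Compare_dec.le_dec (S (n + k)) n); [lia|].
    unfold plus; simpl. unfold Rdiv. ring. }
exists (n1 + n2)%nat, (fun j => (if Compare_dec.le_dec j n1 then d1 j else 0) - (if Compare_dec.le_dec j n2 then d2 j else 0)).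
intro x. unfold divergent_terms.
rewrite <- (Hpad n1 d1 n2 x). rewrite <- (Hpad n2 d2 n1 x), (Nat.add_comm n2 n1).
assert (Hs : forall (u v : nat -> R) m, sum_n_m (fun j => u j - v j) 1 m = sum_n_m u 1 m - sum_n_m v 1 m).
{ intros u v. induction m as [|m IH].
  - rewrite !sum_n_m_zero by lia. unfold zero; simpl. ring.
  - rewrite !sum_n_Sm by lia. rewrite IH. unfold plus; simpl. ring. }
rewrite (sum_n_m_ext (fun j => ((if Compare_dec.le_dec j n1 then d1 j else 0) - (if Compare_dec.le_dec j n2 then d2 j else 0)) / x ^ j)
  (fun j => (if Compare_dec.le_dec j n1 then d1 j else 0) / x ^ j - (if Compare_dec.le_dec j n2 then d2 j else 0) / x ^ j)) by (intro j; unfold Rdiv; (at_type R; ring)).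
rewrite Hs. ring.
Qed.

Lemma is_finite_part_unique (f : R -> R) (m : nat) (a v w : R) : 0 < a ->
  is_finite_part f m a v -> is_finite_part f m a w -> v = w.
Proof.
intros Ha (c1 & n1 & d1 & l1 & H1 & L1) (c2 & n2 & d2 & l2 & H2 & L2).
destruct (divergent_terms_minus n1 n2 d1 d2 l1 l2) as (n & d & Hd).
assert (HL : filterlim (divergent_terms n d (l1 - l2)) (at_right 0) (locally (w - v))).
{ apply (filterlim_ext_loc (fun x => c2 x - c1 x)); [|now apply (filterlim_Rminus (at_right 0))].
  generalize (filter_and _ _ at_right_pos (at_right_lt a Ha)). apply filter_imp. intros x Hx.
  pose proof (is_RInt_unique (V := R_CompleteNormedModule) _ _ _ _ (H1 x Hx)) as E1.
  pose proof (is_RInt_unique (V := R_CompleteNormedModule) _ _ _ _ (H2 x Hx)) as E2.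
  rewrite <- Hd. rewrite E1 in E2. simpl in E2. lra. }
destruct (divergent_terms_limit n d _ _ HL). lra.
Qed.

(** The integral from eps to x is the difference of [fp_series] at the two ends. At eps, the terms n
    < m are inverse powers, n = m is the logarithm, and the terms n > m form [rest], which is
    O(eps). *)
Lemma fp_series_is_finite_part a g (m : nat) (x : R) : power_series a g -> 0 < x ->
  is_finite_part g (S m) x (fp_series a (S m) x).
Proof.
intros Hg Hx.
set (rest := fun e => Series (fun k => a (S m + k)%nat * mono_prim (S m + k) (S m) e)).
(* The power eps^(-j) comes from n = m - j, whose primitive has denominator (n + 1) - (m + 1) = - j;
   signs are reversed because the value at eps is subtracted. *)
exists (fun e => fp_series a (S m) x - rest e), m, (fun j => a (m - j)%nat / INR j), (- a m). split.
- intros e He.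
  replace (fp_series a (S m) x - rest e + divergent_terms m (fun j => a (m - j)%nat / INR j) (- a m) e)
    with (fp_series a (S m) x - fp_series a (S m) e).
  { apply is_RInt_fp; [easy|lra]. }
  unfold fp_series at 2. rewrite (Series_incr_n _ (S m)); [|lia|eexists; apply is_series_fp with g; [easy|lra]].
  fold (rest e). simpl Nat.pred. rewrite <- sum_n_Reals.
  assert (E : sum_n (fun n => a n * mono_prim n (S m) e) m =
    a m * ln e - sum_n_m (fun j => a (m - j)%nat / INR j / e ^ j) 1 m).
  { destruct m as [|q].
    - rewrite sum_O, sum_n_m_zero by lia. unfold zero; simpl. unfold mono_prim. simpl. ring.
    - rewrite sum_Sn. unfold mono_prim at 2. destruct (Nat.eq_dec (S (S q)) (S (S q))) as [_|]; [|easy].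
      rewrite <- (sum_n_m_rev (fun n => a n * mono_prim n (S (S q)) e)).
      assert (Es : forall (u v : nat -> R) p, (forall j, (1 <= j <= p)%nat -> u j = - v j) ->
        sum_n_m u 1 p = - sum_n_m v 1 p).
      { intros u v p H. induction p as [|p IHp].
        - rewrite !sum_n_m_zero by lia. unfold zero; simpl. ring.
        - rewrite !sum_n_Sm, IHp, H by (intros; try apply H; lia). unfold plus; simpl. ring. }
      rewrite (Es _ (fun j => a (S q - j)%nat / INR j / e ^ j)).
      + unfold plus; simpl. ring.
      + intros j Hj. unfold mono_prim. destruct (Nat.eq_dec (S (S q - j)) (S (S q))) as [|_]; [lia|].
        replace (INR (S (S q - j)) - INR (S (S q))) with (- INR j).
        2: { assert (E : INR (S (S q)) = INR (S (S q - j)) + INR j) by (rewrite <- plus_INR; f_equal; lia).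
             rewrite E. ring. }
        assert (E : e ^ S (S q) = e ^ S (S q - j) * e ^ j) by (rewrite <- pow_add; f_equal; lia).
        rewrite E.
        field. repeat split; try (apply pow_nonzero; lra). apply not_0_INR. lia. }
  unfold divergent_terms. rewrite E. ring.
- destruct (power_series_abs a g 1 Hg ltac:(lra)) as [A HA].
  assert (HA1 : ex_series (fun k => Rabs (a (S m + k)%nat))).
  { apply (ex_series_incr_n (V := R_NormedModule) (fun k => Rabs (a k)) (S m)). exists A.
    eapply is_series_ext; [|exact HA]. intro n. simpl. rewrite pow1. apply Rmult_1_r. }
  set (B := Series (fun k => Rabs (a (S m + k)%nat))) in *.
  assert (Hrest : filterlim rest (at_right 0) (locally 0)).
  { apply filterlim_locally. intros eps.
    assert (HB : 0 <= B).
    { eapply Rle_trans; [apply Rabs_pos|]. apply (Series_Rabs (fun k => a (S m + k)%nat)). exact HA1. }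
    assert (Hq : 0 < eps / (B + 1)) by (apply Rdiv_lt_0_compat; [apply cond_pos|lra]).
    generalize (filter_and _ _ at_right_pos (filter_and _ _ (at_right_lt 1 Rlt_0_1) (at_right_lt _ Hq))).
    apply filter_imp. intros e (He0 & He1 & He2).
    unfold ball; simpl; unfold AbsRing_ball, minus, plus, opp, abs; simpl. rewrite Ropp_0, Rplus_0_r.
    (* The primitive of index m + 1 + k is e^(k+1) / (k + 1), at most e when e < 1; hence |rest e|
       <= B e. *)
    assert (Ht : forall k, Rabs (a (S m + k)%nat * mono_prim (S m + k) (S m) e) <= Rabs (a (S m + k)%nat) * e).
    { intro k. rewrite Rabs_mult. apply Rmult_le_compat_l; [apply Rabs_pos|].
      unfold mono_prim. destruct (Nat.eq_dec (S (S m + k)) (S m)) as [|_]; [lia|].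
      replace (S (S m + k)) with (S m + S k)%nat by lia. rewrite plus_INR, pow_add.
      assert (Hk : 1 <= INR (S k)) by (change 1 with (INR 1); apply le_INR; lia).
      replace (INR (S m) + INR (S k) - INR (S m)) with (INR (S k)) by ring.
      generalize dependent (INR (S k)). intros p Hk.
      replace (e ^ S m * e ^ S k / e ^ S m / p) with (e ^ S k * / p)
        by (field; repeat split; try lra; apply pow_nonzero; lra).
      assert (0 <= e ^ k <= 1) by (split; [apply pow_le; lra|rewrite <- (pow1 k); apply pow_incr; lra]).
      assert (0 < / p <= 1) by (split; [apply Rinv_0_lt_compat; lra|rewrite <- Rinv_1; apply Rinv_le_contravar; lra]).
      assert (0 <= e ^ S k <= e) by (simpl; split; nra).
      rewrite Rabs_pos_eq by (apply Rmult_le_pos; lra). nra. }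
    eapply Rle_lt_trans; [apply Series_Rabs|].
    { apply (ex_series_le (V := R_CompleteNormedModule) _ (fun k => Rabs (a (S m + k)%nat) * e)).
      - intro k. change (Rabs (Rabs (a (S m + k)%nat * mono_prim (S m + k) (S m) e)) <= Rabs (a (S m + k)%nat) * e).
        rewrite Rabs_Rabsolu. apply Ht.
      - now apply ex_series_scal_r. }
    eapply Rle_lt_trans; [apply Series_le with (b := fun k => Rabs (a (S m + k)%nat) * e)|].
    { intro k. split; [apply Rabs_pos|apply Ht]. }
    { now apply ex_series_scal_r. }
    rewrite Series_scal_r. fold B.
    replace (pos eps) with ((B + 1) * (eps / (B + 1))) by (field; lra). nra. }
  replace (fp_series a (S m) x) with (fp_series a (S m) x - 0) at 1 by ring.
  apply (filterlim_Rminus (at_right 0)); [apply filterlim_const|exact Hrest].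
Qed.

(** Any [F] allowed by the definition agrees with [fp_series] at each positive point, by uniqueness
    of the finite part there, so it has the same limit and [iota] can only return [v]. *)
Lemma finite_part_infty_of_limit a g (m : nat) (v : R) : power_series a g ->
  is_lim (fp_series a (S m)) p_infty v ->
  is_finite_part_infty g (S m) v /\ finite_part_infty g (S m) = v.
Proof.
intros Hg Hv.
assert (H : is_finite_part_infty g (S m) v).
{ exists (fp_series a (S m)). split; [|exact Hv].
  intros x Hx. now apply fp_series_is_finite_part. }
split; [exact H|].
apply (iota_unique (V := R_CompleteNormedModule)); [|exact H].
intros w (F & HF & Hw).
assert (Hw' : is_lim (fp_series a (S m)) p_infty w).
{ apply (is_lim_ext_loc F); [|exact Hw]. exists 0. intros x Hx.
  apply (is_finite_part_unique g (S m) x); [easy|now apply HF|now apply fp_series_is_finite_part]. }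
apply is_lim_unique in Hv. apply is_lim_unique in Hw'. rewrite Hv in Hw'. now injection Hw'.
Qed.

(** * Abel's test for improper integrals *)

(** The class suited to Abel's test: C^1, nonincreasing and nonnegative on (0, oo). It is closed
    under products, so all the weights used below are built from 1 / (c + x^2) with c >= 0. *)
Definition decreasing_weight (w : R -> R) : Prop :=
  exists dw : R -> R, forall t, 0 < t ->
    is_derive w t (dw t) /\ continuous dw t /\ dw t <= 0 /\ 0 <= w t.

Lemma decreasing_weight_continuous w t : decreasing_weight w -> 0 < t -> continuous w t.
Proof.
intros [dw H] Ht. apply (ex_derive_continuous (V := R_NormedModule) w). eexists. now apply H.
Qed.

Lemma decreasing_weight_le w x y : decreasing_weight w -> 0 < x <= y -> w y <= w x.
Proof.
intros [dw H] Hxy.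
destruct (MVT_gen w x y dw) as (z & Hz & E).
- intros t. rewrite Rmin_left by lra. intros Ht. apply H. lra.
- intros t. rewrite Rmin_left by lra. intros Ht. apply continuity_pt_filterlim.
  apply decreasing_weight_continuous; [now exists dw|lra].
- rewrite Rmin_left, Rmax_right in Hz by lra. destruct (H z ltac:(lra)) as (_ & _ & Hd & _). nra.
Qed.

Lemma decreasing_weight_mult v w : decreasing_weight v -> decreasing_weight w ->
  decreasing_weight (fun t => v t * w t).
Proof.
intros Hv Hw. pose proof Hv as [dv H1]. pose proof Hw as [dw H2].
exists (fun t => dv t * w t + v t * dw t). intros t Ht.
destruct (H1 t Ht) as (D1 & C1 & N1 & P1). destruct (H2 t Ht) as (D2 & C2 & N2 & P2).
split; [|split; [|split]].
- apply (is_derive_mult v w t (dv t) (dw t) D1 D2). intros; apply Rmult_comm.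
- apply (continuous_plus (K := R_AbsRing) (V := R_NormedModule)); apply (continuous_mult (K := R_AbsRing));
    try assumption; now apply decreasing_weight_continuous.
- nra.
- now apply Rmult_le_pos.
Qed.

Lemma decreasing_weight_ext v w : (forall t, v t = w t) -> decreasing_weight v -> decreasing_weight w.
Proof.
intros E [dv H]. exists dv. intros t Ht. destruct (H t Ht) as (D & C & N & P).
split; [|split; [|split]]; try assumption.
- now apply is_derive_ext with v.
- now rewrite <- E.
Qed.

Lemma decreasing_weight_inv_quadratic (c : R) : 0 <= c -> decreasing_weight (fun t => / (c + t ^ 2)).
Proof.
intros Hc. exists (fun t => - (2 * t) / (c + t ^ 2) ^ 2). intros t Ht.
assert (Hq : 0 < c + t ^ 2) by nra.
split; [|split; [|split]].
- auto_derive; [simpl in Hq; lra|]. field. simpl in Hq. lra.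
- apply (ex_derive_continuous (V := R_NormedModule) (fun t => - (2 * t) / (c + t ^ 2) ^ 2)).
  auto_derive. simpl in *. apply Rgt_not_eq. nra.
- unfold Rdiv. assert (0 < / (c + t ^ 2) ^ 2) by (apply Rinv_0_lt_compat, pow_lt; lra). nra.
- left. now apply Rinv_0_lt_compat.
Qed.

Lemma decreasing_weight_inv_even_pow (k : nat) : decreasing_weight (fun t => / t ^ (2 * k)).
Proof.
induction k as [|k IH].
- exists (fun _ => 0). intros t Ht. simpl. split; [|split; [|split]]; try lra.
  + auto_derive; [easy|ring].
  + apply continuous_const.
- apply decreasing_weight_ext with (fun t => / (0 + t ^ 2) * / t ^ (2 * k)).
  + intro t. rewrite <- Rinv_mult. f_equal. rewrite Rplus_0_l, <- pow_add. f_equal. lia.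
  + apply decreasing_weight_mult; [now apply decreasing_weight_inv_quadratic; lra|exact IH].
Qed.

(* Integration by parts: [int g w = G w - int G w'], where [G = int g]. *)
Lemma abel_bound (g w : R -> R) (x y M : R) : 0 < x <= y ->
  (forall t, 0 < t -> continuous g t) -> decreasing_weight w ->
  (forall t, x <= t <= y -> Rabs (RInt g x t) <= M) ->
  Rabs (RInt (fun t => g t * w t) x y) <= M * w x.
Proof.
intros Hxy Hg Hw HM. pose proof Hw as [dw Hdw].
set (G := fun t => RInt g x t).
assert (Hex : forall t, 0 < t -> ex_RInt g x t).
{ intros t Ht. apply (ex_RInt_continuous (V := R_CompleteNormedModule)). intros z Hz. apply Hg.
  pose proof (Rmin_glb_lt x t 0). lra. }
assert (HdG : forall t, 0 < t -> is_derive G t (g t)).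
{ intros t Ht. apply (is_derive_RInt (V := R_NormedModule) g G x t); [|now apply Hg].
  exists (mkposreal t Ht). intros s Hs. apply (RInt_correct (V := R_CompleteNormedModule)). apply Hex.
  unfold ball in Hs; simpl in Hs; unfold AbsRing_ball, minus, plus, opp, abs in Hs; simpl in Hs.
  apply Rabs_def2 in Hs. lra. }
assert (HcG : forall t, 0 < t -> continuous G t).
{ intros t Ht. apply (ex_derive_continuous (V := R_NormedModule) G). eexists. now apply HdG. }
assert (Hmm : forall z, Rmin x y <= z <= Rmax x y -> x <= z <= y)
  by (rewrite Rmin_left, Rmax_right by lra; easy).
assert (Hcw : forall t, 0 < t -> continuous w t) by (intros; now apply decreasing_weight_continuous).
assert (I1 : is_RInt (fun t => g t * w t + G t * dw t) x y (G y * w y - G x * w x)).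
{ apply (is_RInt_derive (V := R_CompleteNormedModule) (fun t => G t * w t)).
  - intros t Ht. apply Hmm in Ht. apply (is_derive_mult G w t (g t) (dw t)).
    + apply HdG; lra.
    + apply Hdw; lra.
    + intros; apply Rmult_comm.
  - intros t Ht. apply Hmm in Ht.
    apply (continuous_plus (K := R_AbsRing) (V := R_NormedModule)); apply (continuous_mult (K := R_AbsRing));
    [apply Hg|apply Hcw|apply HcG|apply Hdw]; lra. }
assert (I2 : is_RInt (fun t => G t * dw t) x y (RInt (fun t => G t * dw t) x y)).
{ apply (RInt_correct (V := R_CompleteNormedModule)), (ex_RInt_continuous (V := R_CompleteNormedModule)).
  intros t Ht. apply Hmm in Ht. apply (continuous_mult (K := R_AbsRing)); [apply HcG|apply Hdw]; lra. }
assert (I3 : is_RInt (fun t => M * - dw t) x y (M * (w x - w y))).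
{ replace (M * (w x - w y)) with (scal M (opp (minus (w y) (w x)))).
  2: { unfold scal, minus, plus, opp; simpl. unfold mult; simpl. ring. }
  apply (is_RInt_scal (V := R_NormedModule)), (is_RInt_opp (V := R_NormedModule)).
  apply (is_RInt_derive (V := R_CompleteNormedModule)); intros t Ht; apply Hmm in Ht; apply Hdw; lra. }
(* Here |dw| = - dw, which integrates to w x - w y. Adding the boundary term at y, at most M w y,
   gives M w x; the boundary term at x is absent because [G] vanishes there. *)
assert (B : Rabs (RInt (fun t => G t * dw t) x y) <= M * (w x - w y)).
{ refine (norm_RInt_le (V := R_NormedModule) _ _ x y _ _ (proj2 Hxy) _ I2 I3).
  intros t Ht. change (Rabs (G t * dw t) <= M * - dw t).
  destruct (Hdw t ltac:(lra)) as (_ & _ & N & _).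
  rewrite Rabs_mult, (Rabs_left1 (dw t)) by easy. apply Rmult_le_compat_r; [lra|]. now apply HM. }
assert (E : RInt (fun t => g t * w t) x y = G y * w y - RInt (fun t => G t * dw t) x y).
{ apply (is_RInt_unique (V := R_CompleteNormedModule)).
  replace (G y * w y - RInt (fun t => G t * dw t) x y) with
    (minus (G y * w y - G x * w x) (RInt (fun t => G t * dw t) x y)).
  - refine (is_RInt_ext (V := R_NormedModule) _ _ _ _ _ _ (is_RInt_minus (V := R_NormedModule) _ _ _ _ _ _ I1 I2)).
    intros t _. unfold minus, plus, opp; simpl. ring.
  - unfold G at 2. rewrite (RInt_point (V := R_CompleteNormedModule)).
    unfold minus, plus, opp, zero; simpl. ring. }
rewrite E. eapply Rle_trans; [apply Rabs_triang|]. rewrite Rabs_Ropp, Rabs_mult.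
destruct (Hdw y ltac:(lra)) as (_ & _ & _ & P). rewrite (Rabs_pos_eq (w y)) by easy.
pose proof (HM y ltac:(lra)) as H. fold (G y) in H. nra.
Qed.

(** Cauchy criterion: far out, the integral of [g] over any interval is at most 2 del, and
    [abel_bound] passes this to g w at the cost of the factor w u <= w a. No absolute convergence is
    involved. *)
Lemma abel_limit (g w : R -> R) (a : R) (l : R) : 0 < a ->
  (forall t, 0 < t -> continuous g t) -> decreasing_weight w ->
  is_lim (fun y => RInt g a y) p_infty l ->
  exists L : R, is_lim (fun y => RInt (fun t => g t * w t) a y) p_infty L.
Proof.
intros Ha Hg Hw Hl.
assert (Hex : forall (h : R -> R) x y, (forall t, 0 < t -> continuous h t) -> 0 < x -> 0 < y -> ex_RInt h x y).
{ intros h x y Hh Hx Hy. apply (ex_RInt_continuous (V := R_CompleteNormedModule)). intros z Hz. apply Hh.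
  pose proof (Rmin_glb_lt x y 0). lra. }
assert (Hgw : forall t, 0 < t -> continuous (fun t => g t * w t) t).
{ intros t Ht. apply (continuous_mult (K := R_AbsRing)); [now apply Hg|now apply decreasing_weight_continuous]. }
assert (Hwa : 0 <= w a) by (destruct Hw as [dw Hdw]; now apply Hdw).
apply (filterlim_locally_cauchy (U := R_CompleteSpace) (F := Rbar_locally' p_infty)).
intros eps.
set (del := eps / (4 * (w a + 1))).
assert (Hdel : 0 < del) by (apply Rdiv_lt_0_compat; [apply cond_pos|lra]).
apply is_lim_spec in Hl. destruct (Hl (mkposreal _ Hdel)) as [A HA]. simpl in HA.
assert (Hmain : forall u v, a <= u -> A < u -> u <= v ->
  Rabs (RInt (fun t => g t * w t) a v - RInt (fun t => g t * w t) a u) < eps).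
{ intros u v Hau HAu Huv.
  assert (E : RInt (fun t => g t * w t) a v - RInt (fun t => g t * w t) a u = RInt (fun t => g t * w t) u v).
  { rewrite <- (RInt_Chasles (V := R_CompleteNormedModule) (fun t => g t * w t) a u v) by (apply Hex; try easy; lra).
    unfold plus; simpl. at_type R. ring. }
  rewrite E.
  apply Rle_lt_trans with (2 * del * w u).
  - apply abel_bound; try assumption; [lra|].
    intros t Ht.
    assert (E2 : RInt g u t = (RInt g a t - l) - (RInt g a u - l)).
    { pose proof (RInt_Chasles (V := R_CompleteNormedModule) g a u t
        (Hex g a u Hg ltac:(lra) ltac:(lra)) (Hex g u t Hg ltac:(lra) ltac:(lra))) as HC.
      unfold plus in HC; simpl in HC. lra. }
    rewrite E2. eapply Rle_trans; [apply Rabs_triang|]. rewrite Rabs_Ropp.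
    pose proof (HA t ltac:(lra)). pose proof (HA u ltac:(lra)). lra.
  - pose proof (decreasing_weight_le w a u Hw ltac:(lra)).
    assert (Hd : del * (4 * (w a + 1)) = eps) by (unfold del; field; lra).
    pose proof (cond_pos eps). nra. }
exists (fun y => a <= y /\ A < y). split.
- exists (Rmax a A). intros x Hx. pose proof (Rmax_l a A). pose proof (Rmax_r a A). lra.
- intros u v [Hu1 Hu2] [Hv1 Hv2].
  unfold ball; simpl; unfold AbsRing_ball, minus, plus, opp, abs; simpl.
  destruct (Rle_lt_dec u v) as [Huv|Huv]; [|rewrite <- Rabs_Ropp, Ropp_plus_distr, Ropp_involutive, Rplus_comm].
  + now apply Hmain.
  + apply Hmain; lra.
Qed.

Lemma abel_limit_bound (g w : R -> R) (a M L : R) : 0 < a ->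
  (forall t, 0 < t -> continuous g t) -> decreasing_weight w ->
  (forall t, a <= t -> Rabs (RInt g a t) <= M) ->
  is_lim (fun y => RInt (fun t => g t * w t) a y) p_infty L -> Rabs L <= M * w a.
Proof.
intros Ha Hg Hw HM HL.
assert (HL' : is_lim (fun y => Rabs (RInt (fun t => g t * w t) a y)) p_infty (Rabs L)).
{ apply (filterlim_comp _ _ _ _ Rabs _ _ _ HL). apply (continuous_Rabs L). }
refine (is_lim_le_loc _ (fun _ => M * w a) p_infty _ _ _ HL' (is_lim_const _ _)).
exists a. intros y Hy. apply abel_bound; try assumption; [lra|].
intros t Ht. apply HM. lra.
Qed.

Lemma RInt_bounded_of_limit (g : R -> R) (a l : R) : 0 < a ->
  (forall t, 0 < t -> continuous g t) -> is_lim (fun y => RInt g a y) p_infty l ->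
  exists M, forall t, a <= t -> Rabs (RInt g a t) <= M.
Proof.
intros Ha Hg Hl. apply is_lim_spec in Hl. destruct (Hl (mkposreal 1 Rlt_0_1)) as [A HA]. simpl in HA.
set (B := Rmax a (A + 1)).
assert (HB : a <= B) by apply Rmax_l.
assert (Hex : forall t, 0 < t -> ex_RInt g a t).
{ intros t Ht. apply (ex_RInt_continuous (V := R_CompleteNormedModule)). intros z Hz. apply Hg.
  pose proof (Rmin_glb_lt a t 0). lra. }
destruct (continuity_ab_maj (fun t => Rabs (RInt g a t)) a B HB) as (t0 & Ht0 & _).
{ intros t Ht. apply continuity_pt_filterlim. apply (continuous_Rabs_comp (fun t => RInt g a t)).
  apply (continuous_RInt_1 (V := R_NormedModule) g a t).
  exists (mkposreal t ltac:(lra)). intros s Hs. apply (RInt_correct (V := R_CompleteNormedModule)). apply Hex.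
  unfold ball in Hs; simpl in Hs; unfold AbsRing_ball, minus, plus, opp, abs in Hs; simpl in Hs.
  apply Rabs_def2 in Hs. lra. }
exists (Rmax (Rabs (RInt g a t0)) (Rabs l + 1)). intros t Ht.
destruct (Rle_lt_dec t B) as [HtB|HtB].
- eapply Rle_trans; [apply Ht0; lra|apply Rmax_l].
- eapply Rle_trans; [|apply Rmax_r].
  assert (HAt : A < t) by (pose proof (Rmax_r a (A + 1)); fold B in H; lra).
  specialize (HA t HAt). replace (RInt g a t) with ((RInt g a t - l) + l) by ring.
  eapply Rle_trans; [apply Rabs_triang|]. lra.
Qed.

(** * The integral near infinity *)

(** Unlike [sum_n], it has exactly [K] terms and is empty at K = 0, the base case of the induction
    on remainders. *)
Fixpoint psum (u : nat -> R) (K : nat) : R :=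
  match K with O => 0 | S k => psum u k + u k end.

Lemma psum_S (u : nat -> R) (K : nat) : psum u (S K) = psum u K + u K.
Proof. reflexivity. Qed.

Lemma psum_S_l (u : nat -> R) (K : nat) : psum u (S K) = u 0%nat + psum (fun k => u (S k)) K.
Proof. induction K as [|K IH]; simpl in *; [ring|rewrite IH; ring]. Qed.

Lemma psum_sum_n (u : nat -> R) (K : nat) : psum u (S K) = sum_n u K.
Proof.
induction K as [|K IH].
- rewrite sum_O. simpl. ring.
- rewrite sum_Sn, <- IH. reflexivity.
Qed.

Lemma psum_ext (u v : nat -> R) (K : nat) : (forall k, u k = v k) -> psum u K = psum v K.
Proof. intros H. induction K as [|K IH]; simpl; [easy|now rewrite IH, H]. Qed.

Lemma psum_0 (u : nat -> R) (K : nat) : (forall k, u k = 0) -> psum u K = 0.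
Proof. intros H. induction K as [|K IH]; simpl; [easy|rewrite IH, H; ring]. Qed.

Lemma psum_scal (c : R) (u : nat -> R) (K : nat) : psum (fun k => c * u k) K = c * psum u K.
Proof. induction K as [|K IH]; simpl; [ring|rewrite IH; ring]. Qed.

Lemma is_series_of_psum_dist (u : nat -> R) (l : R) (d : nat -> R) :
  (forall K, Rabs (psum u K - l) <= d K) -> is_lim_seq d 0 -> is_series u l.
Proof.
intros H Hd. apply (is_lim_seq_of_dist (sum_n u) l (fun K => d (S K))).
- intro n. rewrite <- psum_sum_n. apply H.
- now apply -> (is_lim_seq_incr_1 d).
Qed.

Lemma is_lim_seq_geom_scal (C q : R) : 0 <= q < 1 -> is_lim_seq (fun K => C * q ^ K) 0.
Proof.
intros Hq. replace (Finite 0) with (Rbar_mult C 0) by (simpl; f_equal; ring).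
apply is_lim_seq_scal_l, is_lim_seq_geom. rewrite Rabs_pos_eq; lra.
Qed.

Definition tail_limit (g w : R -> R) (a L : R) : Prop :=
  is_lim (fun y => RInt (fun x => g x * w x) a y) p_infty L.

Lemma tail_limit_lin (g u v w : R -> R) (a k U V : R) : 0 < a ->
  (forall t, 0 < t -> continuous g t) ->
  (forall t, 0 < t -> continuous u t) -> (forall t, 0 < t -> continuous v t) ->
  (forall t, 0 < t -> w t = u t + k * v t) ->
  tail_limit g u a U -> tail_limit g v a V -> tail_limit g w a (U + k * V).
Proof.
intros Ha Hg Hu Hv Hw HU HV. unfold tail_limit in *.
apply (is_lim_ext_loc (fun y => RInt (fun x => g x * u x) a y + k * RInt (fun x => g x * v x) a y)).
- exists a. intros y Hy. symmetry. apply (is_RInt_unique (V := R_CompleteNormedModule)).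
  assert (Hex : forall h : R -> R, (forall t, 0 < t -> continuous h t) ->
    is_RInt (fun x => g x * h x) a y (RInt (fun x => g x * h x) a y)).
  { intros h Hh. apply (RInt_correct (V := R_CompleteNormedModule)), (ex_RInt_continuous (V := R_CompleteNormedModule)).
    rewrite Rmin_left, Rmax_right by lra. intros z Hz.
    apply (continuous_mult (K := R_AbsRing)); [apply Hg|apply Hh]; lra. }
  refine (is_RInt_ext (V := R_NormedModule) _ _ _ _ _ _ (is_RInt_plus (V := R_NormedModule) _ _ _ _ _ _
    (Hex u Hu) (is_RInt_scal (V := R_NormedModule) _ _ _ k _ (Hex v Hv)))).
  rewrite Rmin_left, Rmax_right by lra. intros x Hx. rewrite Hw by lra.
  unfold plus, scal; simpl. unfold mult; simpl. ring.
- apply is_lim_plus'; [exact HU|].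
  replace (Finite (k * V)) with (Rbar_mult k V) by reflexivity.
  now apply is_lim_scal_l.
Qed.

(** With v_k = x^(-2k) / (c + x^2) one has x^(-2k-2) = v_k + c v_(k+1) and x^2 / (c + x^2) = 1 - c
    v_0. After integration against [g] the partial sums telescope, and the remainder is a power of c
    times one integral against v_K. *)
Lemma tail_series (g : R -> R) (a c l : R) : 0 < a -> 0 < c < a ^ 2 ->
  (forall t, 0 < t -> continuous g t) -> is_lim (fun y => RInt g a y) p_infty l ->
  exists (t : nat -> R) (T : R),
    (forall k, tail_limit g (fun x => / x ^ (2 * k)) a (t k)) /\
    tail_limit g (fun x => x ^ 2 * / (c + x ^ 2)) a T /\
    is_series (fun k => (- c) ^ k * t k) T.
Proof.
intros Ha Hc Hg Hl.
set (u := fun (k : nat) x => / x ^ (2 * k)).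
set (v := fun (k : nat) x => / x ^ (2 * k) * / (c + x ^ 2)).
assert (Hu : forall k, decreasing_weight (u k)) by (intro; apply decreasing_weight_inv_even_pow).
assert (Hv : forall k, decreasing_weight (v k)).
{ intro k. apply decreasing_weight_mult; [apply Hu|apply decreasing_weight_inv_quadratic; lra]. }
assert (Hchoose : forall w, decreasing_weight w ->
  tail_limit g w a (real (Lim (fun y => RInt (fun x => g x * w x) a y) p_infty))).
{ intros w Hw. destruct (abel_limit g w a l Ha Hg Hw Hl) as [L HL].
  rewrite (is_lim_unique _ _ _ HL). exact HL. }
set (t := fun k => real (Lim (fun y => RInt (fun x => g x * u k x) a y) p_infty)).
set (s := fun k => real (Lim (fun y => RInt (fun x => g x * v k x) a y) p_infty)).
assert (Ht : forall k, tail_limit g (u k) a (t k)) by (intro; now apply Hchoose).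
assert (Hs : forall k, tail_limit g (v k) a (s k)) by (intro; now apply Hchoose).
assert (Hcu : forall k x, 0 < x -> continuous (u k) x) by (intros; now apply decreasing_weight_continuous).
assert (Hcv : forall k x, 0 < x -> continuous (v k) x) by (intros; now apply decreasing_weight_continuous).
assert (Hrec : forall k, t (S k) = s k + c * s (S k)).
{ intro k.
  assert (H : tail_limit g (u (S k)) a (s k + c * s (S k))).
  { apply (tail_limit_lin g (v k) (v (S k))); auto.
    intros x Hx. unfold u, v. replace (2 * S k)%nat with (2 + 2 * k)%nat by lia. rewrite pow_add.
    assert (x ^ (2 * k) <> 0) by (apply pow_nonzero; lra).
    assert (c + x ^ 2 <> 0) by nra. field. repeat split; try assumption; try lra; apply pow_nonzero; lra. }
  specialize (Ht (S k)). apply is_lim_unique in Ht. apply is_lim_unique in H.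
  rewrite Ht in H. now injection H. }
exists t, (t 0%nat + - c * s 0%nat). split; [exact Ht|]. split.
- apply (tail_limit_lin g (u 0%nat) (v 0%nat)); auto.
  intros x Hx. unfold u, v. simpl. field. nra.
- destruct (RInt_bounded_of_limit g a l Ha Hg Hl) as [M HM].
  assert (Hsum : forall K, psum (fun k => (- c) ^ k * t k) (S K) = t 0%nat + - c * s 0%nat - (- c) ^ S K * s K).
  { induction K as [|K IH]; [simpl; ring|].
    rewrite psum_S, IH, Hrec. simpl. ring. }
  (* Abel's bound gives |s_K| <= M v_K(a) = M a^(-2K) / (c + a^2); with the factor c^(K+1) this is
     geometric of ratio c / a^2 < 1. *)
  apply (is_lim_seq_of_dist _ _ (fun K => M * c / (c + a ^ 2) * (c / a ^ 2) ^ K)).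
  + intro K. rewrite <- psum_sum_n, Hsum.
    replace (t 0%nat + - c * s 0%nat - (- c) ^ S K * s K - (t 0%nat + - c * s 0%nat))
      with (- ((- c) ^ S K * s K)) by ring.
    rewrite Rabs_Ropp, Rabs_mult, <- RPow_abs, Rabs_Ropp, (Rabs_pos_eq c) by lra.
    pose proof (abel_limit_bound g (v K) a M (s K) Ha Hg (Hv K) HM (Hs K)) as HB.
    eapply Rle_trans; [apply Rmult_le_compat_l; [apply pow_le; lra|exact HB]|].
    right. unfold v, Rdiv. rewrite Rpow_mult_distr, pow_inv, <- pow_mult. simpl. field.
    repeat split; first [lra | apply pow_nonzero; lra | nra].
  + apply is_lim_seq_geom_scal. split.
    * apply Rlt_le, Rdiv_lt_0_compat; lra.
    * apply Rlt_div_l; lra.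
Qed.

(** * Taylor remainders of atan and ln (1 + y^2) / 2 *)

Lemma derive_bound_at_zero (f df : R -> R) (y B : R) : 0 < y -> f 0 = 0 ->
  (forall x, 0 <= x <= y -> is_derive f x (df x)) ->
  (forall x, 0 <= x <= y -> Rabs (df x) <= B) -> Rabs (f y) <= y * B.
Proof.
intros Hy H0 Hd HB.
destruct (MVT_gen f 0 y df) as (z & Hz & E).
- intros x. rewrite Rmin_left, Rmax_right by lra. intros. apply Hd. lra.
- intros x. rewrite Rmin_left, Rmax_right by lra. intros. apply continuity_pt_filterlim.
  apply (ex_derive_continuous (V := R_NormedModule) f). eexists. now apply Hd.
- rewrite Rmin_left, Rmax_right in Hz by lra.
  replace (f y) with (f y - f 0) by (rewrite H0; ring). rewrite E, Rabs_mult, Rminus_0_r, (Rabs_pos_eq y) by lra.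
  rewrite Rmult_comm. apply Rmult_le_compat_l; [lra|now apply HB].
Qed.

Lemma is_derive_psum_pow (p : nat -> nat) (x : R) (K : nat) :
  is_derive (fun t => psum (fun k => (-1) ^ k * t ^ S (p k) / INR (S (p k))) K) x
    (psum (fun k => (-1) ^ k * x ^ p k) K).
Proof.
induction K as [|K IH]; simpl psum.
- apply (is_derive_const (V := R_NormedModule)).
- apply (is_derive_plus (V := R_NormedModule)); [exact IH|].
  assert (INR (S (p K)) <> 0) by (apply not_0_INR; lia).
  replace ((-1) ^ K * x ^ p K) with (scal ((-1) ^ K / INR (S (p K))) (INR (S (p K)) * 1 * x ^ Init.Nat.pred (S (p K)))).
  2: { unfold scal; simpl Init.Nat.pred; simpl; unfold mult; simpl.
       change (match p K with 0%nat => 1 | S _ => INR (p K) + 1 end) with (INR (S (p K))). field. assumption. }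
  apply is_derive_ext with (fun t => scal ((-1) ^ K / INR (S (p K))) (t ^ S (p K))).
  { intro t. unfold scal; simpl. unfold mult; simpl. unfold Rdiv. ring. }
  apply (is_derive_scal (fun t => t ^ S (p K))).
  apply (is_derive_pow (fun t => t)). apply (is_derive_id (K := R_AbsRing)).
Qed.

Lemma geometric_alternating (x : R) (s K : nat) :
  psum (fun k => (-1) ^ k * x ^ (2 * k + s)) K = x ^ s * (1 - (-1) ^ K * x ^ (2 * K)) / (1 + x ^ 2).
Proof.
assert (1 + x ^ 2 <> 0) by (pose proof (pow2_ge_0 x); lra).
induction K as [|K IH]; [|rewrite psum_S].
- simpl. field. nra.
- rewrite IH. replace (2 * S K)%nat with (2 * K + 2)%nat by lia. rewrite !pow_add.
  rewrite <- (tech_pow_Rmult (-1)). field. assumption.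
Qed.

(** The derivative of the difference is the remainder (-1)^K x^(2K) / (1 + x^2) of a finite
    geometric sum, at most y^(2K) on [0, y]. The logarithm is treated in the same way with one more
    power of x. *)
Lemma atan_series_bound (y : R) (K : nat) : 0 < y ->
  Rabs (atan y - psum (fun k => (-1) ^ k * y ^ S (2 * k + 0) / INR (S (2 * k + 0))) K) <= y * y ^ (2 * K).
Proof.
intros Hy.
apply (derive_bound_at_zero (fun t => atan t - psum (fun k => (-1) ^ k * t ^ S (2 * k + 0) / INR (S (2 * k + 0))) K)
  (fun x => (-1) ^ K * x ^ (2 * K) / (1 + x ^ 2))); [easy| | |].
- rewrite atan_0. rewrite psum_0; [ring|].
  intro k. rewrite pow_i by lia. unfold Rdiv; ring.
- intros x Hx.
  assert (Hq : 1 + x ^ 2 <> 0) by (pose proof (pow2_ge_0 x); lra).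
  replace ((-1) ^ K * x ^ (2 * K) / (1 + x ^ 2)) with
    (minus (/ (1 + x ^ 2)) (psum (fun k => (-1) ^ k * x ^ (2 * k + 0)) K)).
  + apply (is_derive_minus (V := R_NormedModule)).
    * apply is_derive_Reals. apply derivable_pt_lim_atan.
    * apply (is_derive_psum_pow (fun k => 2 * k + 0)%nat).
  + rewrite geometric_alternating. unfold minus, plus, opp; simpl. field. simpl in Hq. nra.
- intros x Hx. unfold Rdiv. rewrite !Rabs_mult, pow_1_abs, Rmult_1_l.
  assert (0 <= x ^ (2 * K)) by (apply pow_le; lra).
  assert (x ^ (2 * K) <= y ^ (2 * K)) by (apply pow_incr; lra).
  assert (0 < / (1 + x ^ 2) <= 1).
  { pose proof (pow2_ge_0 x). split; [apply Rinv_0_lt_compat; lra|]. rewrite <- Rinv_1. apply Rinv_le_contravar; lra. }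
  rewrite !Rabs_pos_eq by lra. nra.
Qed.

Lemma ln_series_bound (y : R) (K : nat) : 0 < y ->
  Rabs (ln (1 + y ^ 2) / 2 - psum (fun k => (-1) ^ k * y ^ S (2 * k + 1) / INR (S (2 * k + 1))) K)
  <= y * y ^ (2 * K + 1).
Proof.
intros Hy.
apply (derive_bound_at_zero (fun t => ln (1 + t ^ 2) / 2 - psum (fun k => (-1) ^ k * t ^ S (2 * k + 1) / INR (S (2 * k + 1))) K)
  (fun x => (-1) ^ K * x ^ (2 * K + 1) / (1 + x ^ 2))); [easy| | |].
- replace (1 + 0 ^ 2) with 1 by ring. rewrite ln_1. rewrite psum_0; [field|].
  intro k. rewrite pow_i by lia. unfold Rdiv; ring.
- intros x Hx.
  assert (Hq : 0 < 1 + x ^ 2) by (pose proof (pow2_ge_0 x); lra).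
  replace ((-1) ^ K * x ^ (2 * K + 1) / (1 + x ^ 2)) with
    (minus (x / (1 + x ^ 2)) (psum (fun k => (-1) ^ k * x ^ (2 * k + 1)) K)).
  + apply (is_derive_minus (V := R_NormedModule)).
    * auto_derive; [simpl in Hq; lra|]. field. simpl in Hq. lra.
    * apply (is_derive_psum_pow (fun k => 2 * k + 1)%nat).
  + rewrite geometric_alternating, pow_add. unfold minus, plus, opp; simpl. field. simpl in Hq. lra.
- intros x Hx. unfold Rdiv. rewrite !Rabs_mult, pow_1_abs, Rmult_1_l.
  assert (0 <= x ^ (2 * K + 1)) by (apply pow_le; lra).
  assert (x ^ (2 * K + 1) <= y ^ (2 * K + 1)) by (apply pow_incr; lra).
  assert (0 < / (1 + x ^ 2) <= 1).
  { pose proof (pow2_ge_0 x). split; [apply Rinv_0_lt_compat; lra|]. rewrite <- Rinv_1. apply Rinv_le_contravar; lra. }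
  rewrite !Rabs_pos_eq by lra. nra.
Qed.

(** * The integral near zero *)

(* The value of Delta on the monomial [z^n], for [beta = 1 / b^2]. *)
Fixpoint delta_mono (b : R) (n : nat) : R :=
  match n with
  | O => PI / (2 * b)
  | S O => - ln b
  | S (S p) => - b ^ 2 * delta_mono b p
  end.

Lemma nat_ind2 (P : nat -> Prop) : P 0%nat -> P 1%nat -> (forall n, P n -> P (S (S n))) -> forall n, P n.
Proof.
intros H0 H1 H n. cut (P n /\ P (S n)); [tauto|]. induction n as [|n [IH1 IH2]]; auto.
Qed.

Lemma delta_mono_bound (b : R) (n : nat) : 0 < b ->
  Rabs (delta_mono b n) <= (PI / (2 * b) + Rabs (ln b) / b) * b ^ n.
Proof.
intros Hb. assert (0 < PI / (2 * b)) by (apply Rdiv_lt_0_compat; [apply PI_RGT_0|lra]).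
assert (0 <= Rabs (ln b) / b) by (apply Rdiv_le_0_compat; [apply Rabs_pos|lra]).
induction n as [| |n IH] using nat_ind2.
- simpl. rewrite Rabs_pos_eq; lra.
- simpl. rewrite Rabs_Ropp, Rmult_1_r, Rmult_plus_distr_r.
  replace (Rabs (ln b) / b * b) with (Rabs (ln b)) by (field; lra). nra.
- change (delta_mono b (S (S n))) with (- b ^ 2 * delta_mono b n).
  rewrite Rabs_mult, Rabs_Ropp, (Rabs_pos_eq (b ^ 2)) by (apply pow_le; lra).
  replace ((PI / (2 * b) + Rabs (ln b) / b) * b ^ S (S n)) with
    (b ^ 2 * ((PI / (2 * b) + Rabs (ln b) / b) * b ^ n)) by (simpl; ring).
  apply Rmult_le_compat_l; [apply pow_le; lra|exact IH].
Qed.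

Definition mono_int (b a : R) (n : nat) : R := RInt (fun x => x ^ n * / (b ^ 2 + x ^ 2)) 0 a.

(** The remainder R(n, K), with the cut placed at [a]. *)
Definition head_rem (b a : R) (n K : nat) : R :=
  mono_int b a n - delta_mono b n - psum (fun k => (- b ^ 2) ^ k * mono_prim n (2 * k + 2) a) K.

Lemma mono_prim_shift (n m : nat) (x : R) : 0 < x ->
  mono_prim (S (S n)) (S (S m)) x = mono_prim n m x.
Proof.
intros Hx. unfold mono_prim.
destruct (Nat.eq_dec (S (S (S n))) (S (S m))) as [H|H]; destruct (Nat.eq_dec (S n) m) as [H'|H']; try lia; [easy|].
replace (INR (S (S (S n))) - INR (S (S m))) with (INR (S n) - INR m) by (rewrite (S_INR (S (S n))), (S_INR (S n)), (S_INR (S m)), (S_INR m); ring).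
f_equal. simpl. field. split; [apply pow_nonzero|]; lra.
Qed.

Lemma continuous_mono_weight (b x : R) (n : nat) : 0 < b ->
  continuous (fun x => x ^ n * / (b ^ 2 + x ^ 2)) x.
Proof.
intros Hb. assert (0 < b ^ 2) by (apply pow_lt; lra). pose proof (pow2_ge_0 x).
apply (continuous_mult (K := R_AbsRing)); [apply continuous_pow_R|].
apply (ex_derive_continuous (V := R_NormedModule) (fun x => / (b ^ 2 + x ^ 2))). auto_derive. simpl in *; lra.
Qed.

Lemma is_RInt_mono_int (b a : R) (n : nat) : 0 < b ->
  is_RInt (fun x => x ^ n * / (b ^ 2 + x ^ 2)) 0 a (mono_int b a n).
Proof.
intros Hb. apply (RInt_correct (V := R_CompleteNormedModule)), (ex_RInt_continuous (V := R_CompleteNormedModule)).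
intros. now apply continuous_mono_weight.
Qed.

(** Integrate x^(n+2) / (b^2 + x^2) = x^n - b^2 x^n / (b^2 + x^2). The integral of x^n is written as
    [mono_prim (S (S n)) 2 a] because it is the finite part with k = 0 for the monomial x^(n+2). *)
Lemma mono_int_rec (b a : R) (n : nat) : 0 < b -> 0 < a ->
  mono_int b a (S (S n)) = mono_prim (S (S n)) 2 a - b ^ 2 * mono_int b a n.
Proof.
intros Hb Ha. assert (Hb2 : 0 < b ^ 2) by (apply pow_lt; lra).
apply (is_RInt_unique (V := R_CompleteNormedModule)).
assert (HN : INR (S n) <> 0) by (apply not_0_INR; lia).
assert (H1 : is_RInt (fun x => x ^ n) 0 a (mono_prim (S (S n)) 2 a)).
{ replace (mono_prim (S (S n)) 2 a) with (minus (a ^ S n / INR (S n)) (0 ^ S n / INR (S n))).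
  - apply (is_RInt_derive (V := R_CompleteNormedModule) (fun x => x ^ S n / INR (S n))); intros x _; [|apply continuous_pow_R].
    auto_derive; [easy|]. simpl Nat.pred.
    change (match n with 0%nat => 1 | S _ => INR n + 1 end) with (INR (S n)). field. exact HN.
  - rewrite mono_prim_shift by easy. unfold mono_prim. destruct (Nat.eq_dec (S n) 0) as [|_]; [lia|].
    rewrite pow_i by lia. change (INR 0) with 0. unfold minus, plus, opp; simpl pow. rewrite Rminus_0_r.
    simpl Ropp. unfold Rdiv. rewrite Rinv_1.
    simpl. change (match n with 0%nat => 1 | S _ => INR n + 1 end) with (INR (S n)). ring. }
refine (is_RInt_ext (V := R_NormedModule) _ _ _ _ _ _ (is_RInt_minus (V := R_NormedModule) _ _ _ _ _ _ H1
  (is_RInt_scal (V := R_NormedModule) _ _ _ (b ^ 2) _ (is_RInt_mono_int b a n Hb)))).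
intros x _. unfold minus, plus, opp, scal; simpl. unfold mult; simpl. field. nra.
Qed.

(** The term k = 0 of the sum cancels the leading term of [mono_int_rec]. The later terms depend
    only on n - 2k, so they are - b^2 times those of [n], and [delta_mono] scales in the same way by
    definition. *)
Lemma head_rem_rec (b a : R) (n K : nat) : 0 < b -> 0 < a ->
  head_rem b a (S (S n)) (S K) = - b ^ 2 * head_rem b a n K.
Proof.
intros Hb Ha. unfold head_rem. rewrite mono_int_rec, psum_S_l by easy.
rewrite (psum_ext (fun k => (- b ^ 2) ^ S k * mono_prim (S (S n)) (2 * S k + 2) a)
  (fun k => - b ^ 2 * ((- b ^ 2) ^ k * mono_prim n (2 * k + 2) a))).
2: { intro k. replace (2 * S k + 2)%nat with (S (S (2 * k + 2))) by lia. rewrite mono_prim_shift by easy. simpl. ring. }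
rewrite psum_scal. change (delta_mono b (S (S n))) with (- b ^ 2 * delta_mono b n).
simpl (2 * 0 + 2)%nat. simpl ((- b ^ 2) ^ 0). ring.
Qed.

Lemma mono_int_0 (b a : R) : 0 < b -> mono_int b a 0 = atan (a / b) / b.
Proof.
intros Hb. apply (is_RInt_unique (V := R_CompleteNormedModule)).
replace (atan (a / b) / b) with (minus (atan (a / b) / b) (atan (0 / b) / b)).
- apply (is_RInt_derive (V := R_CompleteNormedModule) (fun x => atan (x / b) / b)).
  + intros x _. apply (is_derive_ext (fun x => scal (/ b) (atan (/ b * x)))).
    { intro t. unfold scal; simpl; unfold mult; simpl. unfold Rdiv. rewrite (Rmult_comm t). ring. }
    replace (x ^ 0 * / (b ^ 2 + x ^ 2)) with (scal (/ b) (scal (/ b) (/ (1 + (/ b * x) ^ 2)))).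
    2: { unfold scal; simpl; unfold mult; simpl. field. repeat split; nra. }
    apply (is_derive_scal (fun x => atan (/ b * x))).
    apply (is_derive_comp (V := R_NormedModule) atan (fun x => / b * x)).
    * apply is_derive_Reals, derivable_pt_lim_atan.
    * auto_derive; [easy|ring].
  + intros. now apply continuous_mono_weight.
- unfold Rdiv. rewrite (Rmult_0_l (/ b)), atan_0. unfold minus, plus, opp; simpl. ring.
Qed.

Lemma mono_int_1 (b a : R) : 0 < b -> mono_int b a 1 = ln (b ^ 2 + a ^ 2) / 2 - ln b.
Proof.
intros Hb. apply (is_RInt_unique (V := R_CompleteNormedModule)).
assert (Hb2 : 0 < b ^ 2) by (apply pow_lt; lra).
replace (ln (b ^ 2 + a ^ 2) / 2 - ln b) with (minus (ln (b ^ 2 + a ^ 2) / 2) (ln (b ^ 2 + 0 ^ 2) / 2)).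
- apply (is_RInt_derive (V := R_CompleteNormedModule) (fun x => ln (b ^ 2 + x ^ 2) / 2)).
  + intros x _. pose proof (pow2_ge_0 x). auto_derive; [simpl in *; lra|]. simpl in *. field. nra.
  + intros. now apply continuous_mono_weight.
- replace (b ^ 2 + 0 ^ 2) with (b * b) by ring. rewrite ln_mult by easy.
  unfold minus, plus, opp; simpl. field.
Qed.

Lemma pow_div (x y : R) (n : nat) : (x / y) ^ n = x ^ n / y ^ n.
Proof. unfold Rdiv. now rewrite Rpow_mult_distr, pow_inv. Qed.

(** The PI / 2 in atan (a / b) = PI / 2 - atan (b / a) is cancelled by [delta_mono b 0], which
    leaves - 1 / b times the Taylor remainder of atan at b / a. *)
Lemma head_rem_0_bound (b a : R) (K : nat) : 0 < b -> 0 < a ->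
  Rabs (head_rem b a 0 K) <= / b * (b / a * (b / a) ^ (2 * K)).
Proof.
intros Hb Ha. assert (Hy : 0 < b / a) by now apply Rdiv_lt_0_compat.
assert (E : head_rem b a 0 K = - / b * (atan (b / a) -
  psum (fun k => (-1) ^ k * (b / a) ^ S (2 * k + 0) / INR (S (2 * k + 0))) K)).
{ unfold head_rem. rewrite mono_int_0 by easy.
  replace (a / b) with (/ (b / a)) by (field; lra). rewrite atan_inv by easy.
  rewrite (psum_ext (fun k => (- b ^ 2) ^ k * mono_prim 0 (2 * k + 2) a)
    (fun k => - / b * ((-1) ^ k * (b / a) ^ S (2 * k + 0) / INR (S (2 * k + 0))))).
  - rewrite psum_scal. simpl delta_mono. field. lra.
  - intro k. unfold mono_prim. destruct (Nat.eq_dec 1 (2 * k + 2)) as [|_]; [lia|].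
    rewrite Nat.add_0_r. replace (2 * k + 2)%nat with (S (S (2 * k))) by lia.
    rewrite (S_INR (S (2 * k))). change (INR 1) with 1.
    assert (HN : INR (S (2 * k)) <> 0) by (apply not_0_INR; lia).
    replace (- b ^ 2) with ((-1) * b ^ 2) by ring. rewrite pow_div, Rpow_mult_distr, <- pow_mult.
    rewrite <- !(tech_pow_Rmult _ (S (2 * k))), <- !(tech_pow_Rmult _ (2 * k)).
    replace (1 - (INR (S (2 * k)) + 1)) with (- INR (S (2 * k))) by ring.
    generalize dependent (INR (S (2 * k))). intros p Hp. simpl (a ^ 1). simpl (S 0).
    field. repeat split; try lra; try assumption; apply pow_nonzero; lra. }
rewrite E, Rabs_mult, Rabs_Ropp, (Rabs_pos_eq (/ b)) by (left; now apply Rinv_0_lt_compat).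
apply Rmult_le_compat_l; [left; now apply Rinv_0_lt_compat|]. now apply atan_series_bound.
Qed.

(** For n = 1 the finite part with k = 0 is ln a, and ln (b^2 + a^2) / 2 - ln a = ln (1 + (b / a)^2)
    / 2. That term is spent on the logarithm, hence [S K] here against [K] terms of the Taylor
    sum. *)
Lemma head_rem_1_bound (b a : R) (K : nat) : 0 < b -> 0 < a ->
  Rabs (head_rem b a 1 (S K)) <= (b / a) ^ (2 * S K).
Proof.
intros Hb Ha. assert (Hy : 0 < b / a) by now apply Rdiv_lt_0_compat.
assert (E : head_rem b a 1 (S K) = ln (1 + (b / a) ^ 2) / 2 -
  psum (fun k => (-1) ^ k * (b / a) ^ S (2 * k + 1) / INR (S (2 * k + 1))) K).
{ unfold head_rem. rewrite mono_int_1, psum_S_l by easy.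
  rewrite (psum_ext (fun k => (- b ^ 2) ^ S k * mono_prim 1 (2 * S k + 2) a)
    (fun k => (-1) ^ k * (b / a) ^ S (2 * k + 1) / INR (S (2 * k + 1)))).
  - unfold mono_prim at 1. destruct (Nat.eq_dec 2 (2 * 0 + 2)) as [_|]; [|lia].
    simpl delta_mono. simpl ((- b ^ 2) ^ 0).
    replace (1 + (b / a) ^ 2) with ((b ^ 2 + a ^ 2) * (/ a * / a)) by (field; lra).
    assert (0 < / a) by now apply Rinv_0_lt_compat.
    rewrite !ln_mult by (try apply Rmult_lt_0_compat; try nra; easy). rewrite ln_Rinv by easy. field.
  - intro k. replace (2 * S k + 2)%nat with (S (S (S (S (2 * k))))) by lia.
    unfold mono_prim. destruct (Nat.eq_dec 2 (S (S (S (S (2 * k)))))) as [|_]; [lia|].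
    replace (2 * k + 1)%nat with (S (2 * k)) by lia.
    rewrite (S_INR (S (S (S (2 * k))))), (S_INR (S (S (2 * k)))).
    assert (HN : INR (S (S (2 * k))) <> 0) by (apply not_0_INR; lia).
    rewrite <- (tech_pow_Rmult (- b ^ 2)).
    replace (- b ^ 2) with ((-1) * b ^ 2) by ring. rewrite pow_div, Rpow_mult_distr, <- pow_mult.
    rewrite <- !(tech_pow_Rmult _ (S (S (S (2 * k))))), <- !(tech_pow_Rmult _ (S (S (2 * k)))), <- !(tech_pow_Rmult _ (S (2 * k))), <- !(tech_pow_Rmult _ (2 * k)).
    change (INR 2) with 2.
    replace (2 - (INR (S (S (2 * k))) + 1 + 1)) with (- INR (S (S (2 * k)))) by ring.
    generalize dependent (INR (S (S (2 * k)))). intros p Hp.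
    field. repeat split; try lra; try assumption; apply pow_nonzero; lra. }
rewrite E. eapply Rle_trans; [now apply ln_series_bound|].
right. replace (2 * S K)%nat with (S (2 * K + 1)) by lia. reflexivity.
Qed.

Lemma mono_int_bound (b a : R) (n : nat) : 0 < b -> 0 < a ->
  Rabs (mono_int b a n) <= a / b ^ 2 * a ^ n.
Proof.
intros Hb Ha. assert (Hb2 : 0 < b ^ 2) by (apply pow_lt; lra).
replace (a / b ^ 2 * a ^ n) with ((a - 0) * (a ^ n * / b ^ 2)) by (field; lra).
apply (norm_RInt_le_const (V := R_NormedModule) (fun x => x ^ n * / (b ^ 2 + x ^ 2)) 0 a); [lra| |now apply is_RInt_mono_int].
intros x Hx. pose proof (pow2_ge_0 x).
change (Rabs (x ^ n * / (b ^ 2 + x ^ 2)) <= a ^ n * / b ^ 2).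
rewrite Rabs_mult. apply Rmult_le_compat; try apply Rabs_pos.
- rewrite Rabs_pos_eq by (apply pow_le; lra). apply pow_incr. lra.
- rewrite Rabs_pos_eq by (left; apply Rinv_0_lt_compat; lra). apply Rinv_le_contravar; lra.
Qed.

Lemma head_rem_bound (b a : R) : 0 < b < a ->
  exists C, 0 <= C /\ forall K n, Rabs (head_rem b a n K) <= C * a ^ n * (b / a) ^ (2 * K).
Proof.
intros Hb. assert (Hb2 : 0 < b ^ 2) by (apply pow_lt; lra).
assert (Hy : 0 < b / a) by (apply Rdiv_lt_0_compat; lra).
assert (Hy1 : b / a < 1) by (apply Rlt_div_l; lra).
set (D := PI / (2 * b) + Rabs (ln b) / b).
assert (HD : 0 <= D).
{ unfold D. apply Rplus_le_le_0_compat.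
  - left. apply Rdiv_lt_0_compat; [apply PI_RGT_0|lra].
  - apply Rdiv_le_0_compat; [apply Rabs_pos|lra]. }
assert (Hab : 0 < a / b ^ 2) by (apply Rdiv_lt_0_compat; lra).
assert (Hib : 0 < / b) by (apply Rinv_0_lt_compat; lra).
(* The first two summands bound the integral and Delta at K = 0; / b covers n = 0 and n = 1 at later
   K. For n >= 2 the recursion reproduces the bound with the same constant. *)
set (C := a / b ^ 2 + D + / b).
exists C. split; [unfold C; lra|].
assert (Hyp : forall m, 0 <= (b / a) ^ m) by (intro; apply pow_le; lra).
induction K as [|K IH].
- intro n. unfold head_rem. simpl psum. rewrite Rminus_0_r.
  change ((b / a) ^ (2 * 0)) with 1. rewrite Rmult_1_r.
  eapply Rle_trans; [apply Rabs_triang|]. rewrite Rabs_Ropp.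
  pose proof (mono_int_bound b a n ltac:(lra) ltac:(lra)) as H1.
  pose proof (delta_mono_bound b n ltac:(lra)) as H2. fold D in H2.
  assert (0 <= a ^ n) by (apply pow_le; lra).
  assert (D * b ^ n <= D * a ^ n) by (apply Rmult_le_compat_l; [easy|apply pow_incr; lra]).
  unfold C. nra.
- intro n. destruct n as [|[|n]].
  + eapply Rle_trans; [apply head_rem_0_bound; lra|]. rewrite (pow_O a), Rmult_1_r.
    rewrite <- Rmult_assoc. apply Rmult_le_compat_r; [apply Hyp|]. unfold C. nra.
  + eapply Rle_trans; [apply head_rem_1_bound; lra|].
    rewrite <- (Rmult_1_l ((b / a) ^ (2 * S K))) at 1. apply Rmult_le_compat_r; [apply Hyp|].
    rewrite pow_1. apply Rle_trans with (/ b * a).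
    * rewrite <- (Rinv_l b) by lra. apply Rmult_le_compat_l; lra.
    * apply Rmult_le_compat_r; unfold C; lra.
  + rewrite head_rem_rec by lra. rewrite Rabs_mult, Rabs_Ropp, (Rabs_pos_eq (b ^ 2)) by lra.
    replace (C * a ^ S (S n) * (b / a) ^ (2 * S K)) with (b ^ 2 * (C * a ^ n * (b / a) ^ (2 * K))).
    * apply Rmult_le_compat_l; [lra|apply IH].
    * replace (2 * S K)%nat with (2 + 2 * K)%nat by lia. rewrite (pow_add _ 2), (pow_div b a 2). simpl. field. lra.
Qed.

(** * Summation over the Taylor coefficients *)

Lemma ex_series_delta a g (b : R) : power_series a g -> 0 < b ->
  ex_series (fun n => a n * delta_mono b n).
Proof.
intros Hg Hb.
apply (ex_series_le (V := R_CompleteNormedModule) _ (fun n => (Rabs (a n) * b ^ n) * (PI / (2 * b) + Rabs (ln b) / b))).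
- intro n. change (Rabs (a n * delta_mono b n) <= Rabs (a n) * b ^ n * (PI / (2 * b) + Rabs (ln b) / b)).
  rewrite Rabs_mult, Rmult_assoc. apply Rmult_le_compat_l; [apply Rabs_pos|].
  rewrite (Rmult_comm (b ^ n)). now apply delta_mono_bound.
- apply ex_series_scal_r. apply power_series_abs with g; [easy|lra].
Qed.

(** After K moments the error is the sum over n of a_n R(n, K), at most C (b / x)^(2K) times the sum
    of |a_n| x^n. *)
Lemma head_series a g (b x : R) : power_series a g -> 0 < b < x ->
  is_series (fun k => (- b ^ 2) ^ k * fp_series a (2 * k + 2) x)
    (RInt (fun y => g y * / (b ^ 2 + y ^ 2)) 0 x - Series (fun n => a n * delta_mono b n)).
Proof.
intros Hg Hb. assert (Hb2 : 0 < b ^ 2) by (apply pow_lt; lra).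
set (S0 := RInt (fun y => g y * / (b ^ 2 + y ^ 2)) 0 x).
set (D := Series (fun n => a n * delta_mono b n)).
assert (H1 : is_series (fun n => a n * mono_int b x n) S0).
{ apply RInt_power_series; [easy|lra|]. intros y _. pose proof (pow2_ge_0 y).
  apply (ex_derive_continuous (V := R_NormedModule) (fun x => / (b ^ 2 + x ^ 2))). auto_derive. simpl in *; lra. }
assert (H2 : is_series (fun n => a n * delta_mono b n) D).
{ apply Series_correct. now apply ex_series_delta with g. }
(* For fixed [K] this adds finitely many convergent series in n, so no double series has to be
   interchanged. *)
assert (H3 : forall K, is_series (fun n => a n * psum (fun k => (- b ^ 2) ^ k * mono_prim n (2 * k + 2) x) K)
  (psum (fun k => (- b ^ 2) ^ k * fp_series a (2 * k + 2) x) K)).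
{ induction K as [|K IH].
  - simpl. apply (is_series_ext (fun _ => 0)); [intro; symmetry; apply Rmult_0_r|].
    apply (filterlim_ext (fun _ => 0)); [|apply filterlim_const].
    intro m. rewrite sum_n_const. symmetry; apply Rmult_0_r.
  - rewrite psum_S.
    pose proof (is_series_plus _ _ _ _ IH (is_series_scal_l ((- b ^ 2) ^ K) _ _ (is_series_fp a g (2 * K + 2) x Hg ltac:(lra)))) as HS.
    eapply is_series_ext; [|exact HS]. intro n. rewrite psum_S.
    set (P := psum _ K). set (q := (- b ^ 2) ^ K). set (m := mono_prim n (2 * K + 2) x).
    change (a n * P + q * (a n * m) = a n * (P + q * m)). ring. }
destruct (head_rem_bound b x Hb) as (C & HC & HR).
destruct (power_series_abs a g x Hg ltac:(lra)) as [A HA].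
assert (Hy : 0 < b / x) by (apply Rdiv_lt_0_compat; lra).
assert (Hy1 : b / x < 1) by (apply Rlt_div_l; lra).
apply (is_series_of_psum_dist _ _ (fun K => C * A * ((b / x) ^ 2) ^ K)).
- intro K.
  pose proof (is_series_minus _ _ _ _ (is_series_minus _ _ _ _ H1 H2) (H3 K)) as H4.
  assert (H5 : is_series (fun n => a n * head_rem b x n K)
     (S0 - D - psum (fun k => (- b ^ 2) ^ k * fp_series a (2 * k + 2) x) K)).
  { eapply is_series_ext; [|exact H4]. intro n. unfold head_rem. set (P := psum _ K).
    change (a n * mono_int b x n - a n * delta_mono b n - a n * P = a n * (mono_int b x n - delta_mono b n - P)). ring. }
  rewrite Rabs_minus_sym. rewrite <- (is_series_unique _ _ H5).
  assert (Hle : forall n, Rabs (a n * head_rem b x n K) <= Rabs (a n) * x ^ n * (C * ((b / x) ^ 2) ^ K)).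
  { intro n. rewrite Rabs_mult, Rmult_assoc. apply Rmult_le_compat_l; [apply Rabs_pos|].
    rewrite <- pow_mult. specialize (HR K n). lra. }
  assert (Hex : ex_series (fun n => Rabs (a n) * x ^ n * (C * ((b / x) ^ 2) ^ K))).
  { apply ex_series_scal_r. now exists A. }
  eapply Rle_trans; [apply Series_Rabs|].
  { apply (ex_series_le (V := R_CompleteNormedModule) _ _ (fun n => eq_ind_r (fun z => z <= _) (Hle n) (Rabs_Rabsolu _)) Hex). }
  eapply Rle_trans; [apply Series_le; [|exact Hex]|].
  { intro n. split; [apply Rabs_pos|apply Hle]. }
  rewrite Series_scal_r, (is_series_unique _ _ HA). right; ring.
- apply is_lim_seq_geom_scal. rewrite pow_div. split; [apply Rdiv_le_0_compat; [lra|apply pow_lt; lra]|].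
  apply Rlt_div_l; [apply pow_lt; lra|]. rewrite Rmult_1_l. simpl. nra.
Qed.

(** Both points z = i / sqrt beta and its opposite satisfy z^2 = - 1 / beta, so the left side obeys
    the two-step recursion of [delta_mono]. The difference vanishes at n = 0 and the sum at n = 1;
    ln beta = - 2 ln b accounts for the constants. *)
Lemma delta_mono_complex (beta : R) (n : nat) : 0 < beta ->
  (RtoC (PI * sqrt beta / 4) * ((Ci / RtoC (sqrt beta)) ^ n + (- Ci / RtoC (sqrt beta)) ^ n)
   + RtoC (sqrt beta * ln beta) / (RtoC 4 * Ci)
     * ((Ci / RtoC (sqrt beta)) ^ n - (- Ci / RtoC (sqrt beta)) ^ n))%C
  = RtoC (delta_mono (/ sqrt beta) n).
Proof.
intros Hbeta. assert (Hs : 0 < sqrt beta) by now apply sqrt_lt_R0.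
assert (Hss : sqrt beta * sqrt beta = beta) by (apply sqrt_sqrt; lra).
assert (Hln : ln beta = 2 * ln (sqrt beta)) by (rewrite <- Hss at 1; rewrite ln_mult by easy; ring).
rewrite Hln. set (s := sqrt beta) in *. clearbody s.
assert (Hsc : RtoC s <> RtoC 0) by (intro E; apply RtoC_inj in E; lra).
assert (Hic : Ci <> RtoC 0) by (intro E; injection E; lra).
assert (Ci2 : (Ci * Ci = RtoC (-1))%C) by (unfold Ci, Cmult, RtoC; simpl; f_equal; ring).
assert (H4 : RtoC 4 <> RtoC 0) by (intro E; apply RtoC_inj in E; lra).
assert (H2 : RtoC 2 <> RtoC 0) by (intro E; apply RtoC_inj in E; lra).
induction n as [| |n IH] using nat_ind2.
- simpl Cpow. simpl delta_mono.
  replace (PI / (2 * / s)) with (2 * (PI * s / 4)) by (field; lra).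
  rewrite (RtoC_mult 2 (PI * s / 4)). field; repeat split; assumption.
- simpl Cpow. simpl delta_mono. rewrite ln_Rinv, Ropp_involutive by easy.
  transitivity (RtoC (s * (2 * ln s)) * RtoC 2 / (RtoC 4 * RtoC s))%C; [field; repeat split; assumption|].
  rewrite <- !RtoC_mult, <- RtoC_div by nra. f_equal. field. lra.
- change (delta_mono (/ s) (S (S n))) with (- (/ s) ^ 2 * delta_mono (/ s) n).
  rewrite (RtoC_mult (- (/ s) ^ 2)), <- IH.
  assert (E : forall z, (z * z = RtoC (- (/ s) ^ 2))%C -> (z ^ S (S n) = RtoC (- (/ s) ^ 2) * z ^ n)%C).
  { intros z Hz. rewrite !Cpow_S, <- Hz. ring. }
  assert (Ez : (RtoC (- (/ s) ^ 2) = Ci * Ci * / RtoC s * / RtoC s)%C).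
  { rewrite Ci2, <- RtoC_inv by lra. rewrite <- !RtoC_mult. f_equal. simpl. ring. }
  rewrite (E (Ci / RtoC s)%C), (E (- Ci / RtoC s)%C); [ring| |]; rewrite Ez; field; exact Hsc.
Qed.

(** Delta is linear in the values of [f] at two points, so it commutes with the limit of Taylor
    polynomials, on which it is known monomial by monomial. *)
Lemma stieltjes_Delta_series a g (f : C -> C) (beta : R) : power_series a g -> 0 < beta ->
  (forall z : C, is_lim_seq (fun N => Cmod (f z - sum_n (G := C_AbelianMonoid) (fun n => RtoC (a n) * z ^ n)%C N)) 0) ->
  stieltjes_Delta f beta = RtoC (Series (fun n => a n * delta_mono (/ sqrt beta) n)).
Proof.
intros Hg Hbeta Hf. assert (Hs : 0 < sqrt beta) by now apply sqrt_lt_R0.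
assert (Hd : 0 < / sqrt beta) by now apply Rinv_0_lt_compat.
pose proof (Series_correct _ (ex_series_delta a g (/ sqrt beta) Hg Hd)) as HD.
set (D := Series _) in *.
set (z1 := (Ci / RtoC (sqrt beta))%C). set (z2 := (- Ci / RtoC (sqrt beta))%C).
set (A1 := RtoC (PI * sqrt beta / 4)). set (A2 := (RtoC (sqrt beta * ln beta) / (RtoC 4 * Ci))%C).
set (P := fun z N => sum_n (G := C_AbelianMonoid) (fun n => RtoC (a n) * z ^ n)%C N) in *.
set (Q := fun N => sum_n (fun n => a n * delta_mono (/ sqrt beta) n) N).
assert (HP : forall N, (A1 * (P z1 N + P z2 N) + A2 * (P z1 N - P z2 N))%C = RtoC (Q N)).
{ induction N as [|N IH].
  - unfold P, Q. rewrite !sum_O, RtoC_mult, <- delta_mono_complex by easy. fold z1 z2 A1 A2. ring.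
  - unfold P, Q in *. rewrite !sum_Sn. change (plus ?u ?v) with (u + v)%C at 1 2 3 4.
    change (plus (sum_n (fun n => a n * delta_mono (/ sqrt beta) n) N) (a (S N) * delta_mono (/ sqrt beta) (S N)))
      with (sum_n (fun n => a n * delta_mono (/ sqrt beta) n) N + a (S N) * delta_mono (/ sqrt beta) (S N)).
    rewrite RtoC_plus, <- IH, RtoC_mult, <- delta_mono_complex by easy. fold z1 z2 A1 A2. ring. }
assert (E : (stieltjes_Delta f beta - RtoC D = 0)%C).
{ apply Cmod_eq_0. apply Rle_antisym; [|apply Cmod_ge_0].
  set (M := Cmod A1 + Cmod A2).
  refine (is_lim_seq_le (fun _ => Cmod (stieltjes_Delta f beta - RtoC D))
    (fun N => M * (Cmod (f z1 - P z1 N) + Cmod (f z2 - P z2 N)) +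
       Rabs (Q N - D)) _ 0 _ (is_lim_seq_const _) _).
  - intro N.
    replace (stieltjes_Delta f beta - RtoC D)%C with
      (A1 * ((f z1 - P z1 N) + (f z2 - P z2 N)) + A2 * ((f z1 - P z1 N) + - (f z2 - P z2 N)) +
        RtoC (Q N - D))%C.
    2: { rewrite RtoC_minus, <- HP. unfold stieltjes_Delta. fold z1 z2 A1 A2. ring. }
    eapply Rle_trans; [apply Cmod_triangle|]. rewrite Cmod_R. apply Rplus_le_compat_r.
    eapply Rle_trans; [apply Cmod_triangle|]. rewrite !Cmod_mult. unfold M. rewrite Rmult_plus_distr_r.
    apply Rplus_le_compat; apply Rmult_le_compat_l; try apply Cmod_ge_0.
    + apply Cmod_triangle.
    + eapply Rle_trans; [apply Cmod_triangle|]. rewrite Cmod_opp. lra.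
  - replace (Finite 0) with (Finite (M * (0 + 0) + Rabs (D - D))) by (f_equal; rewrite Rminus_diag, Rabs_R0; ring).
    apply is_lim_seq_plus'.
    + apply (is_lim_seq_scal_l _ M (0 + 0)). apply is_lim_seq_plus'; apply Hf.
    + apply (is_lim_seq_abs _ (D - D)). apply is_lim_seq_minus'; [exact HD|apply is_lim_seq_const]. }
replace (stieltjes_Delta f beta) with (stieltjes_Delta f beta - RtoC D + RtoC D)%C by ring.
rewrite E. ring.
Qed.

(** * The expansion *)

Lemma RInt_gen_limit (f : R -> R) (a : R) :
  ex_RInt_gen f (at_point a) (Rbar_locally p_infty) ->
  exists l : R, is_lim (fun y => RInt f a y) p_infty l.
Proof.
intros [l Hl]. exists l. intros P HP.
destruct (Hl P HP) as [Q S HQ HS H].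
unfold filtermap, Rbar_locally'. apply filter_imp with (2 := HS).
intros y Hy. destruct (H a y HQ Hy) as (z & Hz & HPz). simpl in Hz.
apply (is_RInt_unique (V := R_CompleteNormedModule)) in Hz. now rewrite Hz.
Qed.

Lemma is_RInt_gen_of_limit (f : R -> R) (a l : R) :
  (forall y, a < y -> ex_RInt f a y) -> is_lim (fun y => RInt f a y) p_infty l ->
  is_RInt_gen f (at_point a) (Rbar_locally p_infty) l.
Proof.
intros Hex Hl P HP.
apply Filter_prod with (fun x => x = a) (fun y => a < y /\ P (RInt f a y)).
- reflexivity.
- apply filter_and; [now exists a|exact (Hl P HP)].
- intros x y -> [Hy HPy]. exists (RInt f a y). split; [|exact HPy].
  apply (RInt_correct (V := R_CompleteNormedModule)). now apply Hex.
Qed.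

Theorem theorem4p1 (beta : R) (hbeta : 0 < beta)
    (rho : R -> R) (rhoC : C -> C)
    (hentire : entire rhoC)
    (hext : forall x : R, rhoC (RtoC x) = RtoC (rho x))
    (hint : forall c : R, 0 < c ->
       ex_RInt_gen (fun x => rho x / x ^ 2) (at_point c) (Rbar_locally p_infty)) :
  ex_RInt_gen (stieltjes_integrand rho beta) (at_point 0) (Rbar_locally p_infty)
  /\ (forall k : nat, ex_finite_part_infty rho (2 * k + 2))
  /\ ex_series (fun k : nat => (-1) ^ k / beta ^ k * mu_neg rho k)
  /\ RtoC (RInt_gen (stieltjes_integrand rho beta)
             (at_point 0) (Rbar_locally p_infty))
     = (RtoC (Series (fun k : nat => ((-1) ^ k / beta ^ k * mu_neg rho k)%R))
        + stieltjes_Delta rhoC beta)%C.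
Proof.
destruct (entire_real_power_series rhoC rho hentire hext) as [a Ha].
assert (Hrho : power_series a rho).
{ intro x. apply (is_lim_seq_of_dist _ _ _) with (2 := Ha (RtoC x)).
  intro N. rewrite (sum_n_ext _ (fun n => fst (RtoC (a n)) * x ^ n)) by easy.
  rewrite <- fst_sum_RtoC, hext, Rabs_minus_sym. exact (re_le_Cmod (RtoC (rho x) - _)). }
assert (Hs : 0 < sqrt beta) by now apply sqrt_lt_R0.
set (b := / sqrt beta). assert (Hb : 0 < b) by now apply Rinv_0_lt_compat.
assert (Hb2 : b ^ 2 = 1 / beta).
{ unfold b. rewrite pow_inv. simpl. rewrite Rmult_1_r, sqrt_sqrt by lra. field. lra. }
assert (Hb2p : 0 < b ^ 2) by (apply pow_lt; lra).
(* Any cut beyond [b] would do: the head needs b < x0 and the tail b^2 < x0^2. *)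
set (x0 := 2 * b). assert (Hx0 : 0 < b < x0) by (unfold x0; lra).
set (g := fun x => rho x / x ^ 2).
assert (Hcr : forall x, continuous rho x) by (intro; eapply power_series_continuous; exact Hrho).
assert (Hg : forall x, 0 < x -> continuous g x).
{ intros x Hx. apply (continuous_mult (K := R_AbsRing)); [apply Hcr|now apply continuous_inv_pow]. }
destruct (RInt_gen_limit g x0 (hint x0 ltac:(lra))) as [l Hl].
destruct (tail_series g x0 (b ^ 2) l) as (t & T & Ht & HT & HtT); try easy; [lra|split; [lra|unfold x0; nra]|].
assert (Hmu : forall k, is_finite_part_infty rho (2 * k + 2) (fp_series a (2 * k + 2) x0 + t k) /\
  mu_neg rho k = fp_series a (2 * k + 2) x0 + t k).
{ intro k. unfold mu_neg. replace (2 * k + 2)%nat with (S (2 * k + 1)) by lia.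
  apply finite_part_infty_of_limit with a; [easy|].
  (* [fp_series] is a primitive, so its value at y is its value at x0 plus the ordinary integral
     from x0 to y, whose limit is [t k]. *)
  apply (is_lim_ext_loc (fun y => fp_series a (S (2 * k + 1)) x0 + RInt (fun x => g x * / x ^ (2 * k)) x0 y)).
  - exists x0. intros y Hy.
    assert (E : RInt (fun x => g x * / x ^ (2 * k)) x0 y = fp_series a (S (2 * k + 1)) y - fp_series a (S (2 * k + 1)) x0).
    { apply (is_RInt_unique (V := R_CompleteNormedModule)).
      refine (is_RInt_ext (V := R_NormedModule) _ _ _ _ _ _ (is_RInt_fp a rho (S (2 * k + 1)) x0 y Hrho ltac:(lra))).
      rewrite Rmin_left, Rmax_right by lra. intros x Hx.
      replace (S (2 * k + 1)) with (2 + 2 * k)%nat by lia. unfold g. rewrite pow_add.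
      assert (x ^ (2 * k) <> 0) by (apply pow_nonzero; lra). at_type R. field. split; [assumption|lra]. }
    rewrite E. at_type R. ring.
  - apply is_lim_plus'; [apply is_lim_const|apply Ht]. }
set (S0 := RInt (fun y => rho y * / (b ^ 2 + y ^ 2)) 0 x0).
set (D := Series (fun n => a n * delta_mono b n)).
assert (Hser : is_series (fun k => (-1) ^ k / beta ^ k * mu_neg rho k) (S0 - D + T)).
{ refine (is_series_ext _ _ _ _ (is_series_plus _ _ _ _ (head_series a rho b x0 Hrho Hx0) HtT)).
  intro k. rewrite (proj2 (Hmu k)).
  replace ((-1) ^ k / beta ^ k) with ((- b ^ 2) ^ k).
  - set (q := (- b ^ 2) ^ k). set (F := fp_series _ _ _).
    change (q * F + q * t k = q * (F + t k)). at_type R. ring.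
  - rewrite Hb2, <- pow_div. f_equal. field. lra. }
assert (Hst : forall x, continuous (stieltjes_integrand rho beta) x).
{ intro x. apply (continuous_mult (K := R_AbsRing)); [apply Hcr|]. rewrite <- Hb2.
  pose proof (pow2_ge_0 x).
  apply (ex_derive_continuous (V := R_NormedModule) (fun x => / (b ^ 2 + x ^ 2))). auto_derive. simpl in *; lra. }
assert (Hex : forall u v, ex_RInt (stieltjes_integrand rho beta) u v).
{ intros. apply (ex_RInt_continuous (V := R_CompleteNormedModule)). intros; apply Hst. }
assert (HS : is_RInt_gen (stieltjes_integrand rho beta) (at_point 0) (Rbar_locally p_infty) (S0 + T)).
{ apply is_RInt_gen_of_limit; [intros; apply Hex|].
  (* Beyond x0 the integrand is g times x^2 / (b^2 + x^2), the weight whose tail integral is [T]. *)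
  apply (is_lim_ext_loc (fun y => S0 + RInt (fun x => g x * (x ^ 2 * / (b ^ 2 + x ^ 2))) x0 y)).
  - exists x0. intros y Hy.
    rewrite <- (RInt_Chasles (V := R_CompleteNormedModule) _ 0 x0 y) by apply Hex.
    assert (E : RInt (fun x => g x * (x ^ 2 * / (b ^ 2 + x ^ 2))) x0 y = RInt (stieltjes_integrand rho beta) x0 y).
    { apply (RInt_ext (V := R_CompleteNormedModule)). rewrite Rmin_left, Rmax_right by lra. intros x Hx.
      unfold g, stieltjes_integrand. rewrite Hb2.
      assert (1 / beta + x ^ 2 <> 0) by (rewrite <- Hb2; pose proof (pow2_ge_0 x); lra).
      set (d := 1 / beta + x ^ 2) in *. change (rho x / x ^ 2 * (x ^ 2 * / d) = rho x / d). field. split; [assumption|lra]. }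
    rewrite E. unfold S0. unfold stieltjes_integrand at 2. rewrite <- Hb2. reflexivity.
  - apply is_lim_plus'; [apply is_lim_const|exact HT]. }
split; [eexists; exact HS|]. split; [|split].
- intro k. eexists. exact (proj1 (Hmu k)).
- eexists. exact Hser.
(* The integral is S0 + T and the series is S0 - D + T, so the discrepancy D must be Delta. *)
- rewrite (is_RInt_gen_unique (V := R_CompleteNormedModule) _ _ HS), (is_series_unique _ _ Hser).
  rewrite (stieltjes_Delta_series a rho) by assumption. fold b D.
  rewrite <- RtoC_plus. f_equal. ring.
Qed.
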